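(* Let $e^a{}_\mu$ be a coframe field on a four-dimensional manifold, $g_{\mu\nu}=\eta_{ab}e^a{}_\mu e^b{}_\nu$ with $\eta=\operatorname{diag}(-1,1,1,1)$, let $\omega_\mu{}^a{}_b$ be an arbitrary flat Lorentz spin connection, and let $\kappa^2>0$ be a constant. Let $T^a{}_{\mu\nu}=D_\nu e^a{}_\mu-D_\mu e^a{}_\nu$ with $D_\nu e^a{}_\mu=\partial_\nu e^a{}_\mu+\omega_\nu{}^a{}_b e^b{}_\mu$, and let $$P_a{}^{\mu\nu}=-\frac{2|e|}{\kappa^2}\,e_a{}^\rho S_\rho{}^{\mu\nu},\qquad S_\rho{}^{\mu\nu}=-K^{\mu\nu}{}_\rho+T^\mu\delta^\nu_\rho-T^\nu\delta^\mu_\rho,$$ be the MTEGR momentum. Then, for every flat spin connection $\omega$, $$2D_\nu P_a{}^{\mu\nu}+\frac{\partial(|e|\,\mathcal H_{\rm MTEGR})}{\partial e^a{}_\mu}\bigg|_{P}=-\frac{4}{\kappa^2}\,|e|\;e_a{}^\rho\,G_\rho{}^\mu ,$$ where $G_{\mu\nu}$ is the Einstein tensor of the Levi-Civita connection of $g$ and $D_\nu P_a{}^{\mu\nu}=\partial_\nu P_a{}^{\mu\nu}-\omega_\nu{}^b{}_aP_b{}^{\mu\nu}$.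
   Context: MTEGR is the metric teleparallel equivalent of general relativity. $e_a{}^\mu$ is the inverse of $e^a{}_\mu$ and $|e|=|\det(e^a{}_\mu)|$; $T^\rho{}_{\mu\nu}=e_a{}^\rho T^a{}_{\mu\nu}$; coordinate indices are moved with $g$. The spin connection is metric-compatible, $\omega_{\mu ab}=-\omega_{\mu ba}$ (indices lowered with $\eta$), and flat: $\partial_\mu\omega_\nu{}^a{}_b-\partial_\nu\omega_\mu{}^a{}_b+\omega_\mu{}^a{}_c\omega_\nu{}^c{}_b-\omega_\nu{}^a{}_c\omega_\mu{}^c{}_b=0$. The torsion trace is $T_\mu=T^\rho{}_{\mu\rho}$ and the contortion is $K_{\rho\mu\nu}=\tfrac12(T_{\mu\rho\nu}+T_{\nu\rho\mu}-T_{\rho\mu\nu})$. The Hamiltonian density is the function of $(e^a{}_\mu,P_a{}^{\mu\nu})$ $$|e|\mathcal H_{\rm MTEGR}=-\frac{\kappa^2}{2|e|}\Bigl(P^{\rho\mu\nu}P_{\mu\nu\rho}+\tfrac12\,\widetilde P^\mu\widetilde P_\mu\Bigr),\qquad P^{\rho\mu\nu}=\eta^{ab}e_b{}^\rho P_a{}^{\mu\nu},\quad \widetilde P^\mu=e^a{}_\nu P_a{}^{\mu\nu}$$ (the fiberwise Legendre transform of $|e|\mathcal L=-\frac1{\kappa^2}|e|T^\rho{}_{\mu\nu}S_\rho{}^{\mu\nu}$); the derivative $\partial/\partial e^a{}_\mu|_P$ is taken with the components $P_a{}^{\mu\nu}$ held fixed, and then evaluated at the momentum of $(e,\omega)$.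 Curvature sign: $\bar R^\rho{}_{\sigma\mu\nu}=\partial_\mu\bar\Gamma^\rho{}_{\sigma\nu}-\partial_\nu\bar\Gamma^\rho{}_{\sigma\mu}+\bar\Gamma^\rho{}_{\lambda\mu}\bar\Gamma^\lambda{}_{\sigma\nu}-\bar\Gamma^\rho{}_{\lambda\nu}\bar\Gamma^\lambda{}_{\sigma\mu}$ with $\bar\Gamma$ the Christoffel symbols of $g$, $\bar R_{\sigma\nu}=\bar R^\rho{}_{\sigma\rho\nu}$, $G_{\mu\nu}=\bar R_{\mu\nu}-\tfrac12g_{\mu\nu}\bar R$. *)

(* Defs.v *)
From HB Require Import structures.
From mathcomp Require Import all_boot all_order all_algebra.
From mathcomp Require Import all_classical all_reals all_analysis.
Set Implicit Arguments.
Unset Strict Implicit.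
Unset Printing Implicit Defensive.
Import Order.TTheory GRing.Theory Num.Theory.
Import numFieldNormedType.Exports.
Local Open Scope classical_set_scope.
Local Open Scope ring_scope.

(* Conventions.  Greek (coordinate) and Latin (Lorentz) indices both range over
   'I_4.  A coframe value is a matrix E with E a mu = e^a_mu, so that
   invmx E mu a = e_a^mu.  A spin connection value w satisfies
   w mu a b = omega_mu^a_b.  An array t i j k lists indices in the order in
   which they are written in the tensor, e.g. P a mu nu = P_a^{mu nu}. *)

Section Calculus.
Variable R : realType.
Implicit Types (U : set 'rV[R]_4) (f : 'rV[R]_4 -> R).

Definition partial (mu : 'I_4) f (x : 'rV[R]_4) : R :=
  'D_(delta_mx ord0 mu) f x.

(* Meaningful for open U. *)
Fixpoint Ck (k : nat) U f : Prop :=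
  (forall x, U x -> {for x, continuous f}) /\
  if k is k'.+1 then
    forall mu : 'I_4,
      (forall x, U x -> derivable f x (delta_mx ord0 mu)) /\
      Ck k' U (partial mu f)
  else True.

Definition smooth U f : Prop := forall k, Ck k U f.

End Calculus.

Section Manifold.
Variables (R : realType) (M : topologicalType).

(* A homeomorphism from an open subset of M onto an open subset of R^4; the
   values of the two maps outside these sets are irrelevant. *)
Record chart := Chart {
  chart_dom : set M;
  chart_map : M -> 'rV[R]_4;
  chart_inv : 'rV[R]_4 -> M;
  chart_dom_open : open chart_dom;
  chart_im_open : open (chart_map @` chart_dom);
  chart_mapK : forall p, chart_dom p -> chart_inv (chart_map p) = p;
  chart_map_cont : {within chart_dom, continuous chart_map};
  chart_inv_cont : {within chart_map @` chart_dom, continuous chart_inv} }.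

Definition chart_im (c : chart) : set 'rV[R]_4 := chart_map c @` chart_dom c.

Definition overlap (c d : chart) : set 'rV[R]_4 :=
  chart_map c @` (chart_dom c `&` chart_dom d).

Definition transition (c d : chart) (x : 'rV[R]_4) : 'rV[R]_4 :=
  chart_map d (chart_inv c x).

Definition smooth_atlas (A : set chart) : Prop :=
  (forall p : M, exists2 c, A c & chart_dom c p) /\
  (forall c d, A c -> A d -> forall nu : 'I_4,
     smooth (overlap c d) (fun x => transition c d x ord0 nu)).

(* A smooth one-form given by its components in the charts of A. *)
Definition one_form (A : set chart)
    (w : chart -> 'rV[R]_4 -> 'I_4 -> R) : Prop :=
  (forall c, A c -> forall mu, smooth (chart_im c) (fun x => w c x mu)) /\
  (forall c d, A c -> A d -> forall x, overlap c d x -> forall mu,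
     w c x mu =
     \sum_(nu < 4) partial mu (fun y => transition c d y ord0 nu) x
                   * w d (transition c d x) nu).

Definition coframe_field (A : set chart)
    (e : chart -> 'rV[R]_4 -> 'M[R]_4) : Prop :=
  (forall a : 'I_4, one_form A (fun c x mu => e c x a mu)) /\
  (forall c, A c -> forall x, chart_im c x -> e c x \in unitmx).

End Manifold.

Section Algebra.
Variable R : realType.

Definition eta : 'M[R]_4 :=
  diag_mx (\row_(a < 4) if a == ord0 then -1 else 1).

Definition metric (E : 'M[R]_4) : 'M[R]_4 :=
  \matrix_(mu, nu) \sum_(a < 4) \sum_(b < 4) eta a b * E a mu * E b nu.

Definition metric_inv (E : 'M[R]_4) : 'M[R]_4 := invmx (metric E).

Definition vol (E : 'M[R]_4) : R := `|\det E|.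

Definition kron (mu nu : 'I_4) : R := (mu == nu)%:R.

Definition lower3 (E : 'M[R]_4) (t : 'I_4 -> 'I_4 -> 'I_4 -> R)
    (i j k : 'I_4) : R :=
  \sum_(l < 4) \sum_(m < 4) \sum_(n < 4)
    metric E i l * metric E j m * metric E k n * t l m n.

(* P^{rho mu nu} and \tilde P^mu *)
Definition mom_coord (E : 'M[R]_4) (P : 'I_4 -> 'I_4 -> 'I_4 -> R)
    (rho mu nu : 'I_4) : R :=
  \sum_(a < 4) \sum_(b < 4) invmx eta a b * invmx E rho b * P a mu nu.

Definition mom_trace (E : 'M[R]_4) (P : 'I_4 -> 'I_4 -> 'I_4 -> R)
    (mu : 'I_4) : R :=
  \sum_(a < 4) \sum_(nu < 4) E a nu * P a mu nu.

(* The density |e| H_MTEGR, as a function of independent arguments e and P. *)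
Definition hamiltonian (kappa : R) (E : 'M[R]_4)
    (P : 'I_4 -> 'I_4 -> 'I_4 -> R) : R :=
  - (kappa ^+ 2 / (2 * vol E)) *
  ((\sum_(rho < 4) \sum_(mu < 4) \sum_(nu < 4)
      mom_coord E P rho mu nu * lower3 E (mom_coord E P) mu nu rho)
   + 2^-1 * \sum_(mu < 4) mom_trace E P mu *
       (\sum_(nu < 4) metric E mu nu * mom_trace E P nu)).

End Algebra.

Section Fields.
Variable R : realType.
Implicit Types (e : 'rV[R]_4 -> 'M[R]_4) (w : 'rV[R]_4 -> 'I_4 -> 'M[R]_4).
Implicit Types (x : 'rV[R]_4) (a b : 'I_4).

Definition metric_compatible (w : 'I_4 -> 'M[R]_4) : Prop :=
  forall mu a b, (eta R *m w mu) a b = - (eta R *m w mu) b a.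

Definition spin_curvature w x (mu nu a b : 'I_4) : R :=
  partial mu (fun y => w y nu a b) x - partial nu (fun y => w y mu a b) x
  + \sum_(c < 4) w x mu a c * w x nu c b
  - \sum_(c < 4) w x nu a c * w x mu c b.

(* D_nu e^a_mu *)
Definition covD_coframe e w x (nu a mu : 'I_4) : R :=
  partial nu (fun y => e y a mu) x + \sum_(b < 4) w x nu a b * e x b mu.

(* T^a_{mu nu}, T^rho_{mu nu}, T_{rho mu nu}, T_mu *)
Definition torsion e w x (a mu nu : 'I_4) : R :=
  covD_coframe e w x nu a mu - covD_coframe e w x mu a nu.

Definition torsion_coord e w x (rho mu nu : 'I_4) : R :=
  \sum_(a < 4) invmx (e x) rho a * torsion e w x a mu nu.

Definition torsion_low e w x (rho mu nu : 'I_4) : R :=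
  \sum_(s < 4) metric (e x) rho s * torsion_coord e w x s mu nu.

Definition torsion_trace e w x (mu : 'I_4) : R :=
  \sum_(rho < 4) torsion_coord e w x rho mu rho.

Definition torsion_trace_up e w x (mu : 'I_4) : R :=
  \sum_(nu < 4) metric_inv (e x) mu nu * torsion_trace e w x nu.

(* K_{rho mu nu} and K^{mu nu}_rho *)
Definition contortion e w x (rho mu nu : 'I_4) : R :=
  2^-1 * (torsion_low e w x mu rho nu + torsion_low e w x nu rho mu
          - torsion_low e w x rho mu nu).

Definition contortion_up e w x (mu nu rho : 'I_4) : R :=
  \sum_(s < 4) \sum_(t < 4)
    metric_inv (e x) mu s * metric_inv (e x) nu t * contortion e w x s t rho.

(* S_rho^{mu nu} *)
Definition superpotential e w x (rho mu nu : 'I_4) : R :=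
  - contortion_up e w x mu nu rho
  + torsion_trace_up e w x mu * kron R nu rho
  - torsion_trace_up e w x nu * kron R mu rho.

Definition momentum (kappa : R) e w x (a mu nu : 'I_4) : R :=
  - (2 * vol (e x) / kappa ^+ 2) *
  \sum_(rho < 4) invmx (e x) rho a * superpotential e w x rho mu nu.

(* D_nu P_a^{mu nu}, summed over nu *)
Definition div_momentum (kappa : R) e w x (a mu : 'I_4) : R :=
  \sum_(nu < 4) (partial nu (fun y => momentum kappa e w y a mu nu) x
                 - \sum_(b < 4) w x nu b a * momentum kappa e w x b mu nu).

Definition dhamiltonian_de (kappa : R) (E : 'M[R]_4)
    (P : 'I_4 -> 'I_4 -> 'I_4 -> R) (a mu : 'I_4) : R :=
  'D_(delta_mx a mu) (fun F : 'M[R]_4 => hamiltonian kappa F P) E.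

(* Levi-Civita curvature of metric \o e *)
Definition christoffel e x (rho mu nu : 'I_4) : R :=
  2^-1 * \sum_(s < 4) metric_inv (e x) rho s *
    (partial mu (fun y => metric (e y) s nu) x
     + partial nu (fun y => metric (e y) s mu) x
     - partial s (fun y => metric (e y) mu nu) x).

Definition riemann e x (rho sigma mu nu : 'I_4) : R :=
  partial mu (fun y => christoffel e y rho sigma nu) x
  - partial nu (fun y => christoffel e y rho sigma mu) x
  + \sum_(l < 4) christoffel e x rho l mu * christoffel e x l sigma nu
  - \sum_(l < 4) christoffel e x rho l nu * christoffel e x l sigma mu.

Definition ricci e x (sigma nu : 'I_4) : R :=
  \sum_(rho < 4) riemann e x rho sigma rho nu.

Definition scalar_curvature e x : R :=
  \sum_(mu < 4) \sum_(nu < 4) metric_inv (e x) mu nu * ricci e x mu nu.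

Definition einstein e x (mu nu : 'I_4) : R :=
  ricci e x mu nu - 2^-1 * metric (e x) mu nu * scalar_curvature e x.

(* G_rho^mu *)
Definition einstein_mixed e x (rho mu : 'I_4) : R :=
  \sum_(s < 4) einstein e x rho s * metric_inv (e x) s mu.

End Fields.

Section SpinConnection.
Variables (R : realType) (M : topologicalType).

(* With the coframe global, omega is a matrix of global one-forms. *)
Definition flat_spin_connection (A : set (chart R M))
    (w : chart R M -> 'rV[R]_4 -> 'I_4 -> 'M[R]_4) : Prop :=
  [/\ forall a b : 'I_4, one_form A (fun c x mu => w c x mu a b),
      forall c, A c -> forall x, chart_im c x -> metric_compatible (w c x)
    & forall c, A c -> forall x, chart_im c x -> forall mu nu a b,
        spin_curvature (w c) x mu nu a b = 0].

End SpinConnection.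

(* Main.v *)
(* The statement is pointwise in a chart, and the flat connection
   e_a^rho D_nu e^a_mu turns it into algebra.  This connection has curvature
   zero and makes g parallel, so the Levi-Civita connection is its sum with the
   contortion, and the Riemann tensor becomes a covariant derivative of the
   contortion plus terms quadratic in it.  The divergence of the momentum and the
   derivative of the Hamiltonian are rewritten in the same way.  In the
   orthonormal frame both sides of the field equation are then polynomials in the
   components of the contortion and of its covariant derivative, where they
   coincide, except that the Ricci tensor appears with its two indices exchanged;
   its symmetry comes from the flatness of the connection. *)

Require Import Defs.
From Stdlib Require Import ZArith Ring_polynom InitialRing Ring_theory.
From HB Require Import structures.
From mathcomp Require Import all_boot all_order all_algebra.
From mathcomp Require Import perm ring.
From mathcomp Require Import all_classical all_reals all_analysis.
Import Order.TTheory GRing.Theory Num.Theory.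
Import numFieldNormedType.Exports.
Local Open Scope classical_set_scope.
Local Open Scope ring_scope.
Set Implicit Arguments.
Unset Strict Implicit.
Unset Printing Implicit Defensive.
Local Notation eta := Defs.eta.

(** * Directional derivatives of matrix-valued functions *)

(** The coframe is parallel when the flat connection acts on its coordinate index and [w] on its
    Lorentz index: [dE = E L - w E]. Passing to frame components therefore costs nothing but
    torsion. Derivatives of the coframe, of its inverse and of the volume are traded for [L] and
    [w]; the [w] terms complete partial derivatives to Lorentz-covariant ones, and [L] survives only
    in antisymmetrized or traced combinations that are torsion. The spin connection stays general
    throughout; it is never gauged to zero.

    The final polynomial identity treats the contortion and its covariant derivative as independent
    variables. In reality they are linked by the Bianchi identity of the flat connection, which
    polynomial normalization cannot see; hence the order of the two Ricci indices matters there, and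
    the symmetry has to be supplied from outside. Dividing the field equation by [- |e| / kappa^2]
    makes all coefficients integers, so the check runs over [Z], once for all rings. *)

Section Derivatives.
Context {R : realType} {V : normedModType R}.
Implicit Types (f g : V -> R) (x v : V).

Lemma is_derive_scalar_mul f g x v (df dg : R) :
  is_derive x v f df -> is_derive x v g dg ->
  is_derive x v (fun y => f y * g y) (df * g x + f x * dg).
Proof.
move=> hf hg; apply: is_derive_eq (is_deriveM hf hg) _.
by rewrite addrC ![_ *: _]mulrC [dg * _]mulrC.
Qed.

Lemma is_derive_scalar_sum n (f : 'I_n -> V -> R) x v (df : 'I_n -> R) :
  (forall i, is_derive x v (f i) (df i)) ->
  is_derive x v (fun y => \sum_(i < n) f i y) (\sum_(i < n) df i).
Proof.
move=> hf; have -> : (fun y => \sum_(i < n) f i y) = \sum_(i < n) f i.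
  by apply/funext => y; rewrite fct_sumE.
exact: is_derive_sum.
Qed.

Lemma is_derive_finsum (I : finType) (f : I -> V -> R) x v (df : I -> R) :
  (forall i, is_derive x v (f i) (df i)) ->
  is_derive x v (fun y => \sum_i f i y) (\sum_i df i).
Proof.
move=> hf; rewrite big_enum_val.
have -> : (fun y => \sum_i f i y) =
          (fun y => \sum_(k < #|I|) f (enum_val k) y).
  by apply/funext => y; rewrite big_enum_val.
by apply: is_derive_scalar_sum.
Qed.

Lemma is_derive_scalar_opp f x v (df : R) :
  is_derive x v f df -> is_derive x v (fun y => - f y) (- df).
Proof. by move=> hf; exact: is_deriveN. Qed.

Lemma is_derive_scalar_add f g x v (df dg : R) :
  is_derive x v f df -> is_derive x v g dg ->
  is_derive x v (fun y => f y + g y) (df + dg).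
Proof. by move=> hf hg; exact: is_deriveD. Qed.

Lemma is_derive_scalar_inv f x v (df : R) : f x != 0 ->
  is_derive x v f df -> is_derive x v (fun y => (f y)^-1) (- df / f x ^+ 2).
Proof.
move=> f0 [hf <-]; apply: DeriveDef; first exact: derivableV.
by rewrite deriveV// [_ *: _]mulrC mulrN mulNr.
Qed.

(** Product rule over a sequence. Without repetitions in [r], the test [j == i] replaces exactly one
    factor. *)
Lemma is_derive_prod (I : eqType) (r : seq I) (f : I -> V -> R) x v
    (df : I -> R) : uniq r -> (forall i, is_derive x v (f i) (df i)) ->
  is_derive x v (fun y => \prod_(i <- r) f i y)
    (\sum_(i <- r) \prod_(j <- r) (if j == i then df j else f j x)).
Proof.
move=> + hf; elim: r => [_|i r IH /= /andP[ir ur]].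
  rewrite big_nil; have -> : (fun y => \prod_(i <- [::]) f i y) = cst 1.
    by apply/funext => y; rewrite big_nil.
  exact: is_derive_cst.
have -> : (fun y => \prod_(j <- i :: r) f j y) =
          (fun y => f i y * \prod_(j <- r) f j y).
  by apply/funext => y; rewrite big_cons.
refine (is_derive_eq (is_derive_scalar_mul (hf i) (IH ur)) _).
rewrite big_cons big_cons eqxx; congr (_ * _ + _).
  by rewrite !big_seq; apply: eq_bigr => j jr; case: eqP => // ji; rewrite -ji jr in ir.
rewrite big_distrr/= !big_seq; apply: eq_bigr => j jr.
by rewrite big_cons; case: eqP => // ij; rewrite ij jr in ir.
Qed.

(** Near a point where [f] is nonzero the sign of [f] is constant, so [|f|] is there a constant
    multiple of [f]. Continuity is a separate hypothesis because a derivative in the single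
    direction [v] does not give it. *)
Lemma is_derive_norm f x v (df : R) : f x != 0 -> {for x, continuous f} ->
  is_derive x v f df -> is_derive x v (fun y => `|f y|) (Num.sg (f x) * df).
Proof.
move=> f0 fc hf.
have := near_eq_is_derive (f := fun y => Num.sg (f x) * f y)
  (g := fun y => `|f y|) (a := x) (v := v) (df := Num.sg (f x) * df).
apply.
  case: (ltgtP (f x) 0) f0 => // fx0 _.
    near=> y; have fy : f y < 0 by near: y; exact: (cvgr_lt _ fc).
    by rewrite ltr0_sg// ltr0_norm// mulN1r.
  near=> y; have fy : 0 < f y by near: y; exact: (cvgr_gt _ fc).
  by rewrite gtr0_sg// gtr0_norm// mul1r.
Unshelve. all: by end_near. Qed.

Definition is_derive_mx {m n} x v (A : V -> 'M[R]_(m, n)) (A' : 'M[R]_(m, n)) :=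
  forall i j, is_derive x v (fun y => A y i j) (A' i j).

Lemma is_derive_mx_eq {m n} x v (A : V -> 'M[R]_(m, n)) A' B' :
  is_derive_mx x v A A' -> A' = B' -> is_derive_mx x v A B'.
Proof. by move=> hA <-. Qed.

Lemma is_derive_mx_cst {m n} x v (A : 'M[R]_(m, n)) :
  is_derive_mx x v (fun=> A) 0.
Proof. by move=> i j; rewrite mxE; exact: is_derive_cst. Qed.

Lemma is_derive_mxD {m n} x v (A B : V -> 'M[R]_(m, n)) A' B' :
  is_derive_mx x v A A' -> is_derive_mx x v B B' ->
  is_derive_mx x v (fun y => A y + B y) (A' + B').
Proof.
move=> hA hB i j; rewrite mxE (_ : (fun y => _) = fun y => A y i j + B y i j).
  exact: is_derive_scalar_add.
by apply/funext => y; rewrite mxE.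
Qed.

Lemma is_derive_mxM {m n p} x v (A : V -> 'M[R]_(m, n)) (B : V -> 'M[R]_(n, p))
    A' B' :
  is_derive_mx x v A A' -> is_derive_mx x v B B' ->
  is_derive_mx x v (fun y => A y *m B y) (A' *m B x + A x *m B').
Proof.
move=> hA hB i j; rewrite !mxE -big_split/=.
rewrite (_ : (fun y => _) = fun y => \sum_k A y i k * B y k j).
  by apply: is_derive_scalar_sum => k; exact: is_derive_scalar_mul.
by apply/funext => y; rewrite mxE.
Qed.

Lemma is_derive_mx_tr {m n} x v (A : V -> 'M[R]_(m, n)) A' :
  is_derive_mx x v A A' -> is_derive_mx x v (fun y => (A y)^T) A'^T.
Proof.
move=> hA i j; rewrite mxE (_ : (fun y => _) = fun y => A y j i)//.
by apply/funext => y; rewrite mxE.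
Qed.

Lemma is_derive_mx_scale {m n} x v f (A : V -> 'M[R]_(m, n)) (df : R) A' :
  is_derive x v f df -> is_derive_mx x v A A' ->
  is_derive_mx x v (fun y => f y *: A y) (df *: A x + f x *: A').
Proof.
move=> hf hA i j; rewrite !mxE (_ : (fun y => _) = fun y => f y * A y i j).
  exact: is_derive_scalar_mul.
by apply/funext => y; rewrite mxE.
Qed.

Lemma is_derive_mx_sum {m n} k x v (A : 'I_k -> V -> 'M[R]_(m, n)) A' :
  (forall i, is_derive_mx x v (A i) (A' i)) ->
  is_derive_mx x v (fun y => \sum_i A i y) (\sum_i A' i).
Proof.
move=> hA i j; rewrite summxE (_ : (fun y => _) = fun y => \sum_l A l y i j).
  by apply: is_derive_scalar_sum => l; exact: hA.
by apply/funext => y; rewrite summxE.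
Qed.

Lemma near_eq_is_derive_mx {m n} x v (A B : V -> 'M[R]_(m, n)) A' :
  (\near x, A x = B x) -> is_derive_mx x v A A' -> is_derive_mx x v B A'.
Proof.
move=> AB hA i j; apply: near_eq_is_derive (hA i j).
by near=> y; rewrite (near AB y).
Unshelve. all: by end_near. Qed.

Lemma is_derive_mx_unique {m n} x v (A : V -> 'M[R]_(m, n)) A' B' :
  is_derive_mx x v A A' -> is_derive_mx x v A B' -> A' = B'.
Proof.
move=> hA hB; apply/matrixP => i j.
by rewrite -(@derive_val _ _ _ _ _ _ _ (hA i j)) (@derive_val _ _ _ _ _ _ _ (hB i j)).
Qed.

Definition updrow {n} (A B : 'M[R]_n) (i : 'I_n) : 'M[R]_n :=
  \matrix_(k, l) (if k == i then B k l else A k l).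

Lemma det_updrow n (A B : 'M[R]_n) i :
  \det (updrow A B i) = \sum_j B i j * cofactor A i j.
Proof.
rewrite (expand_det_row _ i); apply: eq_bigr => j _; rewrite mxE eqxx.
congr (_ * _); rewrite /cofactor; congr (_ * \det _).
by apply/matrixP => k l; rewrite !mxE eq_sym (negPf (neq_lift _ _)).
Qed.

Lemma sum_det_updrow n (A B : 'M[R]_n) :
  \sum_i \det (updrow A B i) = \tr (B *m \adj A).
Proof.
apply: eq_bigr => i _; rewrite det_updrow mxE.
by apply: eq_bigr => j _; rewrite mxE.
Qed.

(** Jacobi's formula. Differentiating the Leibniz expansion gives a sum of determinants with one row
    differentiated, and each is expanded in cofactors along that row. *)
Lemma is_derive_det n x v (A : V -> 'M[R]_n) A' :
  is_derive_mx x v A A' ->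
  is_derive x v (fun y => \det (A y)) (\tr (A' *m \adj (A x))).
Proof.
move=> hA; rewrite -sum_det_updrow.
(* The shape in which the product rule delivers the derivative; the term with factor 0 is the
   derivative of the constant sign of the permutation. *)
have -> : \sum_i \det (updrow (A x) A' i) =
    \sum_(s : 'S_n) (0 * \prod_(i <- index_enum 'I_n) A x i (s i) +
      (-1) ^+ s * \sum_(i <- index_enum 'I_n) \prod_(j <- index_enum 'I_n)
        (if j == i then A' j (s j) else A x j (s j))).
  rewrite exchange_big/=; apply: eq_bigr => s _.
  rewrite mul0r add0r big_distrr/=; apply: eq_bigr => i _; congr (_ * _).
  by apply: eq_bigr => j _; rewrite mxE.
apply: is_derive_finsum => s.
apply: (is_derive_scalar_mul (f := cst _)) => //.
  by apply: is_derive_prod => [|i //]; exact: index_enum_uniq.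
Qed.

Lemma continuous_det n (A : V -> 'M[R]_n) x :
  (forall i j, {for x, continuous (fun y => A y i j)}) ->
  {for x, continuous (fun y => \det (A y))}.
Proof.
move=> hA; apply: (cvg_big (op := +%R) (x0 := 0)) => [|s _]; first exact:
  add_continuous.
apply: cvgM; first exact: cvg_cst.
apply: (@cvg_big R _ *%R 1 xpredT _ V (nbhs x) _ (fun i y => A y i (s i))
  (fun i => A x i (s i))) => [|i _]; first exact: mul_continuous.
exact: hA.
Qed.
End Derivatives.

(** * Derivatives of the inverse matrix and of the volume *)

Section InverseVolume.
Context {R : realType} {V : normedModType R}.
Implicit Types (x v : V).

(** Existence is enough: the adjugate only serves to show that the inverse is differentiable, and
    the value of that derivative is found in another way. *)
Lemma is_derive_mx_adj n x v (A : V -> 'M[R]_n) A' :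
  is_derive_mx x v A A' ->
  exists B', is_derive_mx x v (fun y => \adj (A y)) B'.
Proof.
move=> hA; have hadj i j : derivable (fun y => (\adj (A y)) i j) x v.
  have hS : is_derive_mx x v (fun y => row' j (col' i (A y))) (row' j (col' i A')).
    move=> k l; rewrite !mxE (_ : (fun y => _) = fun y => A y (lift j k) (lift i l))//.
    by apply/funext => y; rewrite !mxE.
  rewrite (_ : (fun y => _) =
    fun y => (-1) ^+ (j + i) * \det (row' j (col' i (A y)))); last first.
    by apply/funext => y; rewrite mxE.
  have := is_derive_scalar_mul (is_derive_cst ((-1) ^+ (j + i) : R) x v) (is_derive_det
    hS).
  by case.
exists (\matrix_(i, j) 'D_v (fun y => (\adj (A y)) i j) x) => i j; rewrite mxE.
exact: derivableP.
Qed.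

Lemma unitmx_near n x (A : V -> 'M[R]_n) :
  (forall i j, {for x, continuous (fun y => A y i j)}) ->
  A x \in unitmx -> \near x, A x \in unitmx.
Proof.
move=> hA; rewrite unitmxE unitfE => A0.
have cA := continuous_det hA.
near=> y; rewrite unitmxE unitfE.
near: y; exact: (cvgr_neq0 _ cA).
Unshelve. all: by end_near. Qed.

(** Near [x] the inverse is the adjugate divided by the determinant, hence differentiable. Its
    derivative [C'] is then forced by differentiating [A A^-1 = 1], which gives
    [A' A^-1 + A C' = 0]. *)
Lemma is_derive_invmx n x v (A : V -> 'M[R]_n) A' :
  (forall i j, {for x, continuous (fun y => A y i j)}) ->
  A x \in unitmx -> is_derive_mx x v A A' ->
  is_derive_mx x v (fun y => invmx (A y)) (- (invmx (A x) *m A' *m invmx (A x))).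
Proof.
move=> cA uA hA; have nuA := unitmx_near cA uA.
have det0 : \det (A x) != 0 by rewrite -unitfE -unitmxE.
have [B' hB] := is_derive_mx_adj hA.
have [C' hC] : exists C', is_derive_mx x v (fun y => invmx (A y)) C'.
  have := is_derive_mx_scale (is_derive_scalar_inv (f := fun y => \det (A y)) det0
    (is_derive_det hA)) hB.
  set C' := (X in is_derive_mx _ _ _ X) => hC; exists C'.
  apply: near_eq_is_derive_mx hC.
  by near=> y; rewrite /invmx; have -> : A y \in unitmx by near: y.
apply: (is_derive_mx_eq hC).
have h0 : A' *m invmx (A x) + A x *m C' = 0.
  apply: (is_derive_mx_unique (is_derive_mxM hA hC)).
  apply: near_eq_is_derive_mx (is_derive_mx_cst x v 1%:M).
  by near=> y; rewrite mulmxV//; near: y.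
rewrite -mulmxA; move/eqP: h0; rewrite addrC addr_eq0 => /eqP h0.
by rewrite -mulmxN -h0 mulKmx.
Unshelve. all: by end_near. Qed.

(** Jacobi's formula with [adj A = det A * A^-1]; the sign coming from the absolute value turns
    [det A] into [vol A]. *)
Lemma is_derive_vol x v (A : V -> 'M[R]_4) A' :
  (forall i j, {for x, continuous (fun y => A y i j)}) ->
  A x \in unitmx -> is_derive_mx x v A A' ->
  is_derive x v (fun y => vol (A y)) (vol (A x) * \tr (invmx (A x) *m A')).
Proof.
move=> cA uA hA; have det0 : \det (A x) != 0 by rewrite -unitfE -unitmxE.
apply: is_derive_eq (is_derive_norm (f := fun y => \det (A y)) det0 (continuous_det cA)
  (is_derive_det hA)) _.
have -> : \adj (A x) = \det (A x) *: invmx (A x).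
  by rewrite /invmx uA scalerA divff// scale1r.
by rewrite -scalemxAr mxtraceZ mulrA -normrEsg mxtrace_mulC.
Qed.
End InverseVolume.

(** * Symmetry of second directional derivatives *)

Section Schwarz.
Context {R : realType} {V : normedModType R}.
Implicit Types (x u v : V) (f : V -> R).

(** The offset [w] makes one statement serve both opposite edges of a parallelogram, [w = h v] and
    [w = 0]. *)
Lemma is_derive_line f x u w (s : R) : derivable f (x + s *: u + w) u ->
  is_derive s 1 (fun s => f (x + s *: u + w)) ('D_u f (x + s *: u + w)).
Proof.
move=> df.
have E : (fun h : R => h^-1 *: ((f \o shift (x + s *: u + w)) (h *: u) - f (x + s *: u
  + w)))
  = (fun h : R => h^-1 *: (((fun s => f (x + s *: u + w)) \o shift s) (h *: 1) -
      (fun s => f (x + s *: u + w)) s)).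
  apply/funext => h /=.
  have -> : x + (h *: 1 + s) *: u + w = h *: u + (x + s *: u + w) => //.
  by rewrite [h *: 1]mulr1 scalerDl -!addrA addrCA.
by move: df; rewrite /derivable E => df; apply: DeriveDef => //; rewrite /derive E.
Qed.

Lemma nbhs_parallelogram (x u v : V) (N : set V) : nbhs x N ->
  exists2 h : R, 0 < h & forall s t, 0 <= s <= h -> 0 <= t <= h ->
    N (x + s *: u + t *: v).
Proof.
(* The summand 1 keeps [k] positive when [u = v = 0] and makes the bound by [r] strict. *)
move=> /nbhs_ballP[r /= r0 xN]; set k := `|u| + `|v| + 1.
have k0 : 0 < k by rewrite ltr_wpDl// addr_ge0.
exists (r / k); first by rewrite divr_gt0.
move=> s t /andP[s0 sh] /andP[t0 th]; apply: xN; rewrite -ball_normE/=.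
rewrite -addrA opprD addrA subrr sub0r normrN.
apply: (le_lt_trans (ler_normD _ _)); rewrite !normrZ !ger0_norm//.
apply: (@le_lt_trans _ _ (r / k * (`|u| + `|v|))).
  by rewrite mulrDr lerD// ler_wpM2r.
by rewrite -mulrA gtr_pMr// mulrC ltr_pdivrMr// mul1r ltrDl.
Qed.

(** The mean value theorem twice: along [u] for the difference of [f] between the two opposite
    edges, then along [v] for ['D_u f]. *)
Lemma second_difference f x u v (h : R) : 0 < h ->
  (forall s t, 0 <= s <= h -> 0 <= t <= h ->
     derivable f (x + s *: u + t *: v) u /\
     derivable ('D_u f) (x + s *: u + t *: v) v) ->
  exists s t, [/\ 0 <= s <= h, 0 <= t <= h &
    f (x + h *: u + h *: v) - f (x + h *: u) - (f (x + h *: v) - f x)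
    = h * h * 'D_v ('D_u f) (x + s *: u + t *: v)].
Proof.
move=> h0 df; have h00 : 0 <= h by exact: ltW.
have itvE s : (s \in `[0, h]) = (0 <= s <= h) by rewrite in_itv.
have D1 s : 0 <= s <= h -> is_derive s 1
    (fun s => f (x + s *: u + h *: v) - f (x + s *: u + 0))
    ('D_u f (x + s *: u + h *: v) - 'D_u f (x + s *: u + 0)).
  move=> sh; apply: is_deriveB.
    apply: is_derive_line; apply: (df _ _ _ _).1 => //; by rewrite h00 lexx.
  apply: is_derive_line; rewrite -[0](scale0r v); apply: (df _ _ _ _).1 => //.
  by rewrite lexx h00.
have [s|z zh|s sh E1] := @MVT_segment R
  (fun s => f (x + s *: u + h *: v) - f (x + s *: u + 0))
  (fun s => 'D_u f (x + s *: u + h *: v) - 'D_u f (x + s *: u + 0)) 0 h h00.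
- by move=> sh; apply: D1; rewrite -itvE; exact: subset_itv_oo_cc.
- by apply: derivable_within_continuous => s; rewrite itvE => /D1 [].
move: sh; rewrite itvE => sh.
have D2 t : 0 <= t <= h -> is_derive t 1
    (fun t => 'D_u f (x + s *: u + t *: v + 0)) ('D_v ('D_u f) (x + s *: u + t *: v +
      0)).
  by move=> th; apply: is_derive_line; rewrite addr0; exact: (df _ _ _ _).2.
have [t|z zh|t th E2] := @MVT_segment R
  (fun t => 'D_u f (x + s *: u + t *: v + 0))
  (fun t => 'D_v ('D_u f) (x + s *: u + t *: v + 0)) 0 h h00.
- by move=> th; apply: D2; rewrite -itvE; exact: subset_itv_oo_cc.
- by apply: derivable_within_continuous => t; rewrite itvE => /D2 [].
move: th; rewrite itvE => th.
exists s, t; split => //; move: E1 E2; rewrite !scale0r !addr0 !subr0 => E1 E2.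
by rewrite addrAC opprB addrA addrAC in E1 *; rewrite ?E1 ?E2; ring.
Qed.

(** The second difference over a small parallelogram is [h^2] times either mixed derivative, taken
    at some point of the parallelogram. By continuity each of these values is within [e / 2] of the
    value at [x]. *)
Lemma schwarz f x u v (U : set V) : open U -> U x ->
  (forall y, U y -> [/\ derivable f y u, derivable f y v,
     derivable ('D_u f) y v & derivable ('D_v f) y u]) ->
  {for x, continuous ('D_v ('D_u f))} -> {for x, continuous ('D_u ('D_v f))} ->
  'D_v ('D_u f) x = 'D_u ('D_v f) x.
Proof.
move=> oU Ux df c1 c2; apply/eqP; rewrite -subr_eq0 -normr_le0; apply/ler_addgt0Pl => e
  e0.
rewrite addr0.
have e2 : 0 < e / 2 by rewrite divr_gt0.
have NU : nbhs x U by exact: open_nbhs_nbhs.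
have N (g : V -> R) : {for x, continuous g} -> nbhs x (fun y => `|g x - g y| < e / 2).
  by move=> cg; apply: cvgr_dist_lt.
have N1 := N _ c1.
have N2 := N _ c2.
have [h h0 hN] := nbhs_parallelogram u v (filterI NU (filterI N1 N2)).
clear c1 c2 N N1 N2.
have hh : h * h != 0 by clear -h0; rewrite mulf_neq0// gt_eqF.
have [s [t [sh th E1]]] := second_difference h0 (fun s t hs ht =>
  let: And4 a _ c _ := df _ (hN s t hs ht).1 in conj a c).
have [s' [t' [sh' th' E2]]] : exists s t, [/\ 0 <= s <= h, 0 <= t <= h &
    f (x + h *: v + h *: u) - f (x + h *: v) - (f (x + h *: u) - f x)
    = h * h * 'D_u ('D_v f) (x + s *: v + t *: u)].
  apply: second_difference => // s' t' hs ht.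
  by rewrite addrAC; have [_ d1 _ d2] := df _ (hN t' s' ht hs).1; exact: conj d1 d2.
(* The second difference is symmetric in [u] and [v], so the two mean values coincide after
   cancelling [h^2]. *)
have E : 'D_v ('D_u f) (x + s *: u + t *: v) = 'D_u ('D_v f) (x + s' *: v + t' *: u).
  apply: (mulfI hh); apply: (etrans (esym E1)); apply: (etrans _ E2).
  rewrite [x + h *: v + _]addrAC; clear.
  by move: (f _) (f _) (f _) (f _) => p q r s0; ring.
have [_ [/= b1 _]] := hN s t sh th.
have [_ [/= _ b2]] := hN t' s' th' sh'.
rewrite addrAC -E in b2.
move: b1 b2; clear; move: ('D_v ('D_u f) x) ('D_v ('D_u f) (x + _ + _)) ('D_u ('D_v f)
  x).
move=> a b c b1 b2; rewrite (le_trans (ler_distD b _ _))//.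
rewrite [e]splitr; apply: lerD; apply: ltW; [exact: b1|rewrite distrC; exact: b2].
Qed.
End Schwarz.

(** * The identity in an orthonormal frame *)

Section FrameAlgebra.
Context {R : comNzRingType}.
Implicit Types (k : 'I_4 -> 'I_4 -> 'I_4 -> R)
  (Dk : 'I_4 -> 'I_4 -> 'I_4 -> 'I_4 -> R).

(* Frame arrays carry all-lower orthonormal indices, [k a b c] being the contortion
   K_{abc} and [Dk d] its covariant derivative in the direction e_d; [sg4] is the
   diagonal of eta and raises an index. *)
Definition sg4 (a : 'I_4) : R := if a == ord0 then -1 else 1.
Definition delta4 (a b : 'I_4) : R := (a == b)%:R.

(** Inverse of the contortion formula on torsions antisymmetric in the last two indices, see
    [torsion_of_contortion_of]. *)
Definition torsion_of k a b c := k b a c - k c a b.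
(** The trace [T^r_{br}]; the second term of [torsion_of] has dropped out by antisymmetry of the
    contortion in its first two indices. *)
Definition torsion_vector k b := \sum_(r < 4) sg4 r * k b r r.
Definition superpot k a b c :=
  - k b c a + torsion_vector k b * (sg4 c * delta4 c a) - torsion_vector k c * (sg4 b *
    delta4 b a).
Definition superpot_up k a b c := sg4 b * sg4 c * superpot k a b c.
Definition superpot_trace k b := \sum_(a < 4) superpot_up k a b a.

(** Curvature [R^a_{bcd}] of the flat connection plus [K]: the antisymmetrized covariant derivative
    of [K], the commutator of [K] with itself, and a torsion term, because the antisymmetrized
    derivative is taken with a connection that has torsion. *)
Definition frame_riemann k Dk a b c d : R :=
  sg4 a * (Dk c a b d - Dk d a b c)
  + \sum_(e < 4) (sg4 a * k a e c * (sg4 e * k e b d)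
                - sg4 a * k a e d * (sg4 e * k e b c)
                - sg4 a * k a b e * (sg4 e * torsion_of k e c d)).
Definition frame_ricci k Dk b d := \sum_(a < 4) frame_riemann k Dk a b a d.
Definition frame_scalar k Dk := \sum_(b < 4) sg4 b * frame_ricci k Dk b b.

(** Twice the bracket of the Hamiltonian density, with the superpotential in place of the momentum;
    doubling removes the coefficient 1/2. *)
Definition frame_quad k :=
  2 * (\sum_(b < 4) \sum_(c < 4) \sum_(d < 4)
     sg4 c * superpot_up k d b c * superpot_up k b c d)
  + \sum_(b < 4) sg4 b * (superpot_trace k b * superpot_trace k b).

(** [frame_div] minus half of [frame_torsion_term] is the frame form of the divergence of the
    momentum, up to a factor ([div_momentumE]). The terms without derivative come from
    differentiating the volume and the inverse coframes. *)
Definition frame_div k Dk a f : R :=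
  \sum_(c < 4) (sg4 f * sg4 c * superpot (Dk c) a f c - torsion_vector k c *
    superpot_up k a f c).
Definition frame_torsion_term k a f : R :=
  \sum_(b < 4) \sum_(c < 4) (sg4 f * torsion_of k f b c) * superpot_up k a b c.
(** Half the response of [frame_quad] to a variation of the coframe at fixed coordinate components
    of the momentum ([bmom_dfmom]). *)
Definition frame_quad_grad k a f : R :=
  2 * (\sum_(c < 4) \sum_(d < 4) sg4 c * (superpot_up k a c d * superpot_up k d f c))
  + 2 * (\sum_(b < 4) \sum_(d < 4) sg4 a * (superpot_up k b a d * superpot_up k d b f))
  + sg4 a * superpot_trace k a * superpot_trace k f + \sum_(b < 4) sg4 b *
    superpot_trace k b * superpot_up k a b f.

Let i0 : 'I_4 := @Ordinal 4 0 isT.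
Let i1 : 'I_4 := @Ordinal 4 1 isT.
Let i2 : 'I_4 := @Ordinal 4 2 isT.
Let i3 : 'I_4 := @Ordinal 4 3 isT.

Lemma sum4E (F : 'I_4 -> R) : \sum_(i < 4) F i = F i0 + F i1 + F i2 + F i3.
Proof.
rewrite !big_ord_recr big_ord0 /= add0r.
by congr (F _ + F _ + F _ + F _); exact: val_inj.
Qed.

Lemma ord4P (P : 'I_4 -> Prop) : P i0 -> P i1 -> P i2 -> P i3 -> forall i, P i.
Proof.
move=> ? ? ? ? [[|[|[|[|//]]]] p];
  by [rewrite (_ : Ordinal p = i0)//; apply: val_inj|rewrite (_ : Ordinal p = i1)//;
    apply: val_inj
   |rewrite (_ : Ordinal p = i2)//; apply: val_inj|rewrite (_ : Ordinal p = i3)//;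
     apply: val_inj].
Qed.

(* The identity is checked on each of its 16 components by normalizing integer
   polynomials in the 24 independent components of the contortion and the 96 of its
   derivative; the [e...] definitions mirror those above as syntactic polynomials. *)
Local Notation PE := (PExpr Z).
Definition esum (F : 'I_4 -> PE) : PE :=
  PEadd (PEadd (PEadd (F i0) (F i1)) (F i2)) (F i3).
Definition esg (a : 'I_4) : PE := if a == ord0 then PEopp PEI else PEI.
Definition edelta (a b : 'I_4) : PE := if a == b then PEI else PEO.
(** Variables of [PExpr] are numbered from 1, hence the successor. *)
Definition epos (n : nat) : positive := Pos.of_succ_nat n.
Definition evar (a b c : 'I_4) : PE := PEX Z (epos (a * 16 + b * 4 + c)).
(** Positions below 64 hold the contortion; each direction [d] of the derivative then takes a block
    of 64. *)
Definition edvar (d a b c : 'I_4) : PE := PEX Z (epos (64 + d * 64 + a * 16 + b * 4 +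
  c)).
(** Only variables with [a < b] occur, so antisymmetry is built into the polynomials and
    normalization has no relations to respect. *)
Definition ealt (v : 'I_4 -> 'I_4 -> 'I_4 -> PE) (a b c : 'I_4) : PE :=
  if (a < b)%N then v a b c else if (b < a)%N then PEopp (v b a c) else PEO.

Let ord4s := [:: i0; i1; i2; i3].
Definition env3 (v : 'I_4 -> 'I_4 -> 'I_4 -> R) : list R :=
  flatten [seq flatten [seq [seq v a b c | c <- ord4s] | b <- ord4s] | a <- ord4s].
Definition env (v : 'I_4 -> 'I_4 -> 'I_4 -> R) Dv : list R :=
  env3 v ++ flatten [seq env3 (Dv d) | d <- ord4s].

Implicit Types (K : 'I_4 -> 'I_4 -> 'I_4 -> PE)
  (DK : 'I_4 -> 'I_4 -> 'I_4 -> 'I_4 -> PE).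
Local Infix "+'" := (@PEadd Z) (at level 50, left associativity).
Local Infix "-'" := (@PEsub Z) (at level 50, left associativity).
Local Infix "*'" := (@PEmul Z) (at level 40, left associativity).
Let e2 : PE := PEadd PEI PEI.

Definition etorsion_of K a b c := K b a c -' K c a b.
Definition etorsion_vector K b := esum (fun r => esg r *' K b r r).
Definition esuperpot K a b c := PEopp (K b c a)
  +' etorsion_vector K b *' (esg c *' edelta c a) -' etorsion_vector K c *' (esg b *'
    edelta b a).
Definition esuperpot_up K a b c := esg b *' esg c *' esuperpot K a b c.
Definition esuperpot_trace K b := esum (fun a => esuperpot_up K a b a).
Definition eframe_riemann K DK a b c d :=
  esg a *' (DK c a b d -' DK d a b c)
  +' esum (fun e => esg a *' K a e c *' (esg e *' K e b d)
                -' esg a *' K a e d *' (esg e *' K e b c)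
                -' esg a *' K a b e *' (esg e *' etorsion_of K e c d)).
Definition eframe_ricci K DK b d := esum (fun a => eframe_riemann K DK a b a d).
Definition eframe_scalar K DK := esum (fun b => esg b *' eframe_ricci K DK b b).
Definition eframe_quad K :=
  e2 *' (esum (fun b => esum (fun c => esum (fun d =>
     esg c *' esuperpot_up K d b c *' esuperpot_up K b c d))))
  +' esum (fun b => esg b *' (esuperpot_trace K b *' esuperpot_trace K b)).
Definition eframe_div K DK a f :=
  esum (fun c => esg f *' esg c *' esuperpot (DK c) a f c -' etorsion_vector K c *'
    esuperpot_up K a f c).
Definition eframe_torsion_term K a f :=
  esum (fun b => esum (fun c => (esg f *' etorsion_of K f b c) *' esuperpot_up K a b
    c)).
Definition eframe_quad_grad K a f :=
  e2 *' (esum (fun c => esum (fun d => esg c *' (esuperpot_up K a c d *' esuperpot_up K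
    d f c))))
  +' e2 *' (esum (fun b => esum (fun d => esg a *' (esuperpot_up K b a d *'
    esuperpot_up K d b f))))
  +' esg a *' esuperpot_trace K a *' esuperpot_trace K f
  +' esum (fun b => esg b *' esuperpot_trace K b *' esuperpot_up K a b f).
(** [elhs] and [erhs] are the coefficients of [e_f^mu] in the two sides of the field equation
    divided by [- |e| / kappa^2]; this is where 4, 2 and 1 come from. *)
Definition elhs K DK a f :=
  e2 *' e2 *' eframe_div K DK a f -' e2 *' eframe_torsion_term K a f -' edelta a f *'
    eframe_quad K
   +' e2 *' eframe_quad_grad K a f.
Definition erhs K DK a f :=
  esg f *' (e2 *' e2 *' eframe_ricci K DK f a -' e2 *' (esg a *' edelta a f) *'
    eframe_scalar K DK).

(** Equality of the normal forms computed by the normalizer behind [ring], with no rewriting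
    hypotheses. The terms are closed integer polynomials, so it can be run by [vm_compute]. *)
Definition zpeq (p q : PE) : bool :=
  Ring_polynom.Peq Zeq_bool (norm_subst Z0 (Zpos xH) Z.add Z.mul Z.sub Z.opp Zeq_bool
      (triv_div Z0 (Zpos xH) Zeq_bool) 0 nil p)
    (norm_subst Z0 (Zpos xH) Z.add Z.mul Z.sub Z.opp Zeq_bool
      (triv_div Z0 (Zpos xH) Zeq_bool) 0 nil q).

Lemma frame_identity_normalized : all (fun a => all (fun f =>
  zpeq (elhs (ealt evar) (fun d => ealt (edvar d)) a f)
       (erhs (ealt evar) (fun d => ealt (edvar d)) a f)) ord4s) ord4s.
Proof. by vm_compute. Qed.

(** * Evaluation of the syntactic polynomials in [R] *)

Let rsub (x y : R) := x - y.
Let rpow (x : R) (n : N) := pow_N 1 *%R x n.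
Let ring_R : ring_theory 0 1 +%R *%R rsub -%R (@eq R).
Proof.
split; [exact: add0r|exact: addrC|exact: addrA|exact: mul1r|exact: mulrC
  |exact: mulrA|exact: mulrDl|by []|exact: subrr].
Qed.
Let pow_R : power_theory 1 *%R (@eq R) id rpow.
Proof. by split. Qed.
Definition ev (l : list R) (p : PE) : R :=
  PEeval 0 1 +%R *%R rsub -%R (gen_phiZ 0 1 +%R *%R -%R) id rpow l p.

Lemma zpeqP l p q : zpeq p q -> ev l p = ev l q.
Proof.
have eqR := Eqsth R; have extR := Eq_ext +%R *%R (-%R : R -> R).
have mor := gen_phiZ_morph eqR extR ring_R.
have almost := Rth_ARth eqR extR ring_R.
move=> pq; apply: (ring_correct eqR extR almost mor pow_R
  (triv_div_th eqR extR almost mor) 0%N l nil) => //.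
Qed.

Section Evaluation.
Variables (l : list R) (K : 'I_4 -> 'I_4 -> 'I_4 -> PE)
  (DK : 'I_4 -> 'I_4 -> 'I_4 -> 'I_4 -> PE).
Let k a b c := ev l (K a b c).
Let Dk d a b c := ev l (DK d a b c).

Lemma evD p q : ev l (PEadd p q) = ev l p + ev l q. Proof. by []. Qed.
Lemma evB p q : ev l (PEsub p q) = ev l p - ev l q. Proof. by []. Qed.
Lemma evM p q : ev l (PEmul p q) = ev l p * ev l q. Proof. by []. Qed.
Lemma evN p : ev l (PEopp p) = - ev l p. Proof. by []. Qed.
Lemma ev2 : ev l e2 = 2. Proof. by []. Qed.
Lemma ev_sum F : ev l (esum F) = \sum_(i < 4) ev l (F i).
Proof. by rewrite sum4E. Qed.
Lemma ev_sg a : ev l (esg a) = sg4 a.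
Proof. by rewrite /esg /sg4; case: ifP. Qed.
Lemma ev_delta a b : ev l (edelta a b) = delta4 a b.
Proof. by rewrite /edelta /delta4; case: ifP. Qed.
Let evE := (evM, ev2, ev_sg, ev_delta).

Lemma ev_torsion_vector b : ev l (etorsion_vector K b) = torsion_vector k b.
Proof. by rewrite ev_sum; apply: eq_bigr => r _; rewrite !evE. Qed.
Lemma ev_superpot a b c : ev l (esuperpot K a b c) = superpot k a b c.
Proof. by rewrite evB evD evN !evE !ev_torsion_vector. Qed.
Lemma ev_superpot_up a b c : ev l (esuperpot_up K a b c) = superpot_up k a b c.
Proof. by rewrite 2!evM !ev_sg ev_superpot. Qed.
Lemma ev_superpot_trace b : ev l (esuperpot_trace K b) = superpot_trace k b.
Proof. by rewrite ev_sum; apply: eq_bigr => r _; rewrite ev_superpot_up. Qed.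
Lemma ev_frame_riemann a b c d : ev l (eframe_riemann K DK a b c d) = frame_riemann k
  Dk a b c d.
Proof.
rewrite evD evM ev_sum !(evB, evE); congr (_ + _); apply: eq_bigr => e _.
by rewrite !(evB, evE).
Qed.
Lemma ev_frame_ricci b d : ev l (eframe_ricci K DK b d) = frame_ricci k Dk b d.
Proof. by rewrite ev_sum; apply: eq_bigr => r _; rewrite ev_frame_riemann. Qed.
Lemma ev_frame_scalar : ev l (eframe_scalar K DK) = frame_scalar k Dk.
Proof. by rewrite ev_sum; apply: eq_bigr => r _; rewrite !evE ev_frame_ricci. Qed.
Lemma ev_frame_quad : ev l (eframe_quad K) = frame_quad k.
Proof.
rewrite evD evM ev2 !ev_sum; congr (_ * _ + _); apply: eq_bigr => b _.
  rewrite ev_sum; apply: eq_bigr => c _.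
  by rewrite ev_sum; apply: eq_bigr => d _; rewrite 2!evM !ev_superpot_up ev_sg.
by rewrite !evE !ev_superpot_trace.
Qed.
Lemma ev_frame_torsion_term a f : ev l (eframe_torsion_term K a f) = frame_torsion_term
  k a f.
Proof.
rewrite ev_sum; apply: eq_bigr => b _; rewrite ev_sum; apply: eq_bigr => c _.
by rewrite 2!evM ev_sg ev_superpot_up.
Qed.
Lemma ev_frame_quad_grad a f : ev l (eframe_quad_grad K a f) = frame_quad_grad k a f.
Proof.
rewrite 3!evD; congr (_ + _ + _ + _).
- rewrite evM ev2 ev_sum; congr (_ * _); apply: eq_bigr => b _.
  by rewrite ev_sum; apply: eq_bigr => d _; rewrite 2!evM !ev_superpot_up ev_sg.
- rewrite evM ev2 ev_sum; congr (_ * _); apply: eq_bigr => b _.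
  by rewrite ev_sum; apply: eq_bigr => d _; rewrite 2!evM !ev_superpot_up ev_sg.
- by rewrite !evE !ev_superpot_trace.
- by rewrite ev_sum; apply: eq_bigr => b _; rewrite 2!evM ev_sg ev_superpot_trace
  ev_superpot_up.
Qed.
End Evaluation.

Lemma ev_frame_div l K DK a f :
  ev l (eframe_div K DK a f) =
  frame_div (fun a b c => ev l (K a b c)) (fun d a b c => ev l (DK d a b c)) a f.
Proof.
rewrite /eframe_div ev_sum; apply: eq_bigr => c _.
by rewrite evB 3!evM !ev_sg ev_superpot ev_torsion_vector ev_superpot_up.
Qed.

Lemma nth_env3 v Dv (a b c : 'I_4) : ev (env v Dv) (evar a b c) = v a b c.
Proof. by move: a b c; do 3 apply: ord4P; vm_compute. Qed.

Lemma nth_denv v Dv (d a b c : 'I_4) : ev (env v Dv) (edvar d a b c) = Dv d a b c.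
Proof. by move: d a b c; do 4 apply: ord4P; vm_compute. Qed.

(** The vanishing diagonal is assumed separately because in a general commutative ring [r = - r]
    does not force [r = 0]. *)
Lemma ev_alt l K (k : 'I_4 -> 'I_4 -> 'I_4 -> R) :
  (forall a b c, k a b c = - k b a c) -> (forall a c, k a a c = 0) ->
  (forall a b c, ev l (K a b c) = k a b c) ->
  (fun a b c => ev l (ealt K a b c)) = k.
Proof.
move=> kN k0 Kk; apply/funext => a; apply/funext => b; apply/funext => c.
rewrite /ealt; case: ltngtP => [ab|ba|/val_inj <-]; first exact: Kk.
  by rewrite evN Kk -kN.
by rewrite k0.
Qed.

(** Nothing relates [Dk] to [k] here beyond their common antisymmetry, so the indices [f a] of
    [frame_ricci] appear in the order dictated by the algebra. *)
Lemma frame_identity (k : 'I_4 -> 'I_4 -> 'I_4 -> R)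
    (Dk : 'I_4 -> 'I_4 -> 'I_4 -> 'I_4 -> R) a f :
  (forall a b c, k a b c = - k b a c) -> (forall a c, k a a c = 0) ->
  (forall d a b c, Dk d a b c = - Dk d b a c) -> (forall d a c, Dk d a a c = 0) ->
  2 * 2 * frame_div k Dk a f - 2 * frame_torsion_term k a f - delta4 a f * frame_quad k
    + 2 * frame_quad_grad k a f
  = sg4 f * (2 * 2 * frame_ricci k Dk f a - 2 * (sg4 a * delta4 a f) * frame_scalar k
    Dk).
Proof.
move=> kN k0 DkN Dk0; set l := env k Dk.
have Ek : (fun a b c => ev l (ealt evar a b c)) = k.
  by apply: ev_alt => // *; exact: nth_env3.
have EDk : (fun d a b c => ev l (ealt (edvar d) a b c)) = Dk.
  by apply/funext => d; apply: ev_alt => // *; exact: nth_denv.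
have : zpeq (elhs (ealt evar) (fun d => ealt (edvar d)) a f)
            (erhs (ealt evar) (fun d => ealt (edvar d)) a f).
  have /allP/(_ a) := frame_identity_normalized.
  have ino (i : 'I_4) : i \in ord4s by move: i; apply: ord4P.
  by move=> /(_ (ino _))/allP/(_ f); apply; exact: ino.
move=> /(@zpeqP l); rewrite /elhs /erhs evD evB evB !evM evB !evM !(ev2, ev_sg,
  ev_delta).
by rewrite ev_frame_div ev_frame_torsion_term ev_frame_quad ev_frame_quad_grad
  ev_frame_ricci ev_frame_scalar Ek EDk.
Qed.
End FrameAlgebra.

(** * Index transformations *)

Section IndexTransforms.
Context {R : realType}.
Implicit Types (t u : 'I_4 -> 'I_4 -> 'I_4 -> R) (A B E : 'M[R]_4).

(** Matrices acting on one index of an array. Actions on different slots commute and actions on the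
    same slot compose, so changes of basis and raising or lowering of indices become matrix
    algebra. *)
Definition slot1 A t : 'I_4 -> 'I_4 -> 'I_4 -> R :=
  fun i j k => \sum_(l < 4) A i l * t l j k.
Definition slot2 A t : 'I_4 -> 'I_4 -> 'I_4 -> R :=
  fun i j k => \sum_(l < 4) A j l * t i l k.
Definition slot3 A t : 'I_4 -> 'I_4 -> 'I_4 -> R :=
  fun i j k => \sum_(l < 4) A k l * t i j l.

Lemma ext3 t u : (forall i j k, t i j k = u i j k) -> t = u.
Proof. by move=> tu; do 3 (apply/funext => ?). Qed.

Lemma slot1M A B t : slot1 A (slot1 B t) = slot1 (A *m B) t.
Proof.
apply: ext3 => i j k; rewrite /slot1; under eq_bigr do rewrite big_distrr/=.
rewrite exchange_big/=; apply: eq_bigr => m _; rewrite mxE big_distrl/=.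
by apply: eq_bigr => l _; rewrite mulrA.
Qed.

Lemma slot2M A B t : slot2 A (slot2 B t) = slot2 (A *m B) t.
Proof.
apply: ext3 => i j k; rewrite /slot2; under eq_bigr do rewrite big_distrr/=.
rewrite exchange_big/=; apply: eq_bigr => m _; rewrite mxE big_distrl/=.
by apply: eq_bigr => l _; rewrite mulrA.
Qed.

Lemma slot3M A B t : slot3 A (slot3 B t) = slot3 (A *m B) t.
Proof.
apply: ext3 => i j k; rewrite /slot3; under eq_bigr do rewrite big_distrr/=.
rewrite exchange_big/=; apply: eq_bigr => m _; rewrite mxE big_distrl/=.
by apply: eq_bigr => l _; rewrite mulrA.
Qed.

Lemma slot12C A B t : slot1 A (slot2 B t) = slot2 B (slot1 A t).
Proof.
apply: ext3 => i j k; rewrite /slot1 /slot2; under eq_bigr do rewrite big_distrr/=.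
rewrite exchange_big/=; apply: eq_bigr => m _; rewrite big_distrr/=.
by apply: eq_bigr => l _; rewrite mulrCA.
Qed.

Lemma slot13C A B t : slot1 A (slot3 B t) = slot3 B (slot1 A t).
Proof.
apply: ext3 => i j k; rewrite /slot1 /slot3; under eq_bigr do rewrite big_distrr/=.
rewrite exchange_big/=; apply: eq_bigr => m _; rewrite big_distrr/=.
by apply: eq_bigr => l _; rewrite mulrCA.
Qed.

Lemma slot23C A B t : slot2 A (slot3 B t) = slot3 B (slot2 A t).
Proof.
apply: ext3 => i j k; rewrite /slot2 /slot3; under eq_bigr do rewrite big_distrr/=.
rewrite exchange_big/=; apply: eq_bigr => m _; rewrite big_distrr/=.
by apply: eq_bigr => l _; rewrite mulrCA.
Qed.

Lemma sum_delta n (f : 'I_n -> R) (i : 'I_n) : \sum_(l < n) (i == l)%:R * f l = f i.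
Proof.
rewrite (bigD1 i)//= eqxx mul1r big1 ?addr0// => l li.
by rewrite eq_sym (negPf li) mul0r.
Qed.

Lemma slot1_1 t : slot1 1%:M t = t.
Proof.
apply: ext3 => i j k; rewrite -(sum_delta (fun l => t l j k) i).
by apply: eq_bigr => l _; rewrite mxE.
Qed.

Lemma slot2_1 t : slot2 1%:M t = t.
Proof.
apply: ext3 => i j k; rewrite -(sum_delta (fun l => t i l k) j).
by apply: eq_bigr => l _; rewrite mxE.
Qed.

Lemma slot3_1 t : slot3 1%:M t = t.
Proof.
apply: ext3 => i j k; rewrite -(sum_delta (fun l => t i j l) k).
by apply: eq_bigr => l _; rewrite mxE.
Qed.

Lemma slot_sum A B C t i j k : slot1 A (slot2 B (slot3 C t)) i j k =
  \sum_(l < 4) \sum_(m < 4) \sum_(n < 4) A i l * B j m * C k n * t l m n.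
Proof.
rewrite /slot1 /slot2 /slot3; apply: eq_bigr => l _; rewrite big_distrr/=.
apply: eq_bigr => m _; rewrite !big_distrr/=.
by apply: eq_bigr => n _; rewrite !mulrA.
Qed.

Lemma etaE a b : eta R a b = sg4 a * delta4 a b.
Proof. by rewrite !mxE -mulr_natr. Qed.

Lemma sg4K (a : 'I_4) : sg4 a * sg4 a = 1 :> R.
Proof. by rewrite /sg4; case: ifP; rewrite ?mulrNN mulr1. Qed.

Lemma sum_eta (f : 'I_4 -> R) a : \sum_(b < 4) eta R a b * f b = sg4 a * f a.
Proof.
rewrite -(sum_delta f a) big_distrr/=; apply: eq_bigr => b _.
by rewrite etaE /delta4 mulrA.
Qed.

Lemma eta_tr : (eta R)^T = eta R.
Proof. by rewrite /eta tr_diag_mx. Qed.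

Lemma etaK : eta R *m eta R = 1%:M.
Proof.
apply/matrixP => a b; rewrite mxE sum_eta etaE mulrA sg4K mul1r mxE.
by rewrite /delta4.
Qed.

Lemma invmx_eta : invmx (eta R) = eta R.
Proof.
have /mulmx1_unit[u _] := etaK.
by rewrite -[LHS]mulmx1 -etaK mulKmx.
Qed.

Lemma slot1_eta t i j k : slot1 (eta R) t i j k = sg4 i * t i j k.
Proof. exact: (sum_eta (fun l => t l j k)). Qed.

Lemma slot3_eta t i j k : slot3 (eta R) t i j k = sg4 k * t i j k.
Proof. exact: (sum_eta (fun l => t i j l)). Qed.

Lemma metricE E : metric E = E^T *m eta R *m E.
Proof.
apply/matrixP => i j; rewrite -mulmxA !mxE; apply: eq_bigr => a _.
rewrite !mxE big_distrr/=; apply: eq_bigr => b _.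
by rewrite mulrA [E a i * _]mulrC.
Qed.

Lemma metric_tr E : (metric E)^T = metric E.
Proof. by rewrite metricE !trmx_mul eta_tr trmxK mulmxA. Qed.

Section Invertible.
Variables (E : 'M[R]_4) (uE : E \in unitmx).
Let F := invmx E.

Lemma FE : F *m E = 1%:M. Proof. exact: mulVmx. Qed.
Lemma EF : E *m F = 1%:M. Proof. exact: mulmxV. Qed.
Lemma FETr : E^T *m F^T = 1%:M. Proof. by rewrite -trmx_mul FE trmx1. Qed.
Lemma EFTr : F^T *m E^T = 1%:M. Proof. by rewrite -trmx_mul EF trmx1. Qed.

Lemma metric_invE : metric_inv E = F *m eta R *m F^T.
Proof.
have h : metric E *m (F *m eta R *m F^T) = 1%:M.
  rewrite metricE -!mulmxA (mulmxA E) EF mul1mx (mulmxA (eta R)) etaK mul1mx.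
  exact: FETr.
have [ug _] := mulmx1_unit h.
by rewrite /metric_inv -[LHS]mulmx1 -h mulKmx.
Qed.

Lemma metric_F : metric E *m F = E^T *m eta R.
Proof. by rewrite metricE -mulmxA EF mulmx1. Qed.

Lemma metric_inv_ET : metric_inv E *m E^T = F *m eta R.
Proof. rewrite metric_invE -(mulmxA (F *m eta R)). by rewrite EFTr mulmx1. Qed.

Lemma metric_invK : metric_inv E *m metric E = 1%:M.
Proof. by rewrite metricE !mulmxA metric_inv_ET -(mulmxA F) etaK mulmx1 FE. Qed.
End Invertible.
End IndexTransforms.

(** * Torsion, contortion and momentum in the frame *)

Section FrameTensors.
Context {R : realType}.
Implicit Types (t u : 'I_4 -> 'I_4 -> 'I_4 -> R) (E : 'M[R]_4).

Definition contortion_of t a b c : R := 2^-1 * (t b a c + t c a b - t a b c).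

Lemma contortion_ofN t a b c : (forall a b c, t a b c = - t a c b) ->
  contortion_of t a b c = - contortion_of t b a c.
Proof.
by move=> tN; rewrite /contortion_of (tN c b a) (tN a b c) (tN b a c); ring.
Qed.

Lemma contortion_of_diag t a c : (forall a b c, t a b c = - t a c b) -> contortion_of t
  a a c = 0.
Proof.
move=> tN; rewrite /contortion_of addrAC subrr add0r.
have /eqP := tN c a a; rewrite -subr_eq0 opprK -mulr2n mulrn_eq0/=.
by move=> /eqP ->; rewrite mulr0.
Qed.

Lemma torsion_of_contortion_of t : (forall a b c, t a b c = - t a c b) -> torsion_of
  (contortion_of t) = t.
Proof.
move=> tN; apply: ext3 => a b c; rewrite /torsion_of /contortion_of.
by rewrite (tN a c b) (tN c b a) (tN b c a); field.
Qed.

Definition pull E t := slot1 E^T (slot2 E^T (slot3 E^T t)).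

Lemma pullE E t i j k : pull E t i j k =
  \sum_(l < 4) \sum_(m < 4) \sum_(n < 4) E l i * E m j * E n k * t l m n.
Proof.
rewrite /pull slot_sum; do 3 (apply: eq_bigr => ? _).
by rewrite !mxE.
Qed.

(** All three slots are transformed by the same matrix, so [pull] commutes with the index
    permutations in the contortion formula. *)
Lemma pull_contortion_of E t i j k : pull E (contortion_of t) i j k = contortion_of
  (pull E t) i j k.
Proof.
have p1 : pull E t j i k = pull E (fun a b c => t b a c) i j k.
  rewrite !pullE exchange_big/=; apply: eq_bigr => l _; apply: eq_bigr => m _.
  by apply: eq_bigr => n _; ring.
have p2 : pull E t k i j = pull E (fun a b c => t c a b) i j k.
  rewrite !pullE exchange_big/=; apply: eq_bigr => l _; rewrite exchange_big/=.
  apply: eq_bigr => m _.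
  by apply: eq_bigr => n _; ring.
rewrite /contortion_of p1 p2 !pullE -!big_split/= -sumrB big_distrr/=; apply: eq_bigr
  => l _.
rewrite -!big_split/= -sumrB big_distrr/=; apply: eq_bigr => m _.
rewrite -!big_split/= -sumrB big_distrr/=; apply: eq_bigr => n _.
by ring.
Qed.

Section AtAPoint.
Variables (e : 'rV[R]_4 -> 'M[R]_4) (w : 'rV[R]_4 -> 'I_4 -> 'M[R]_4).
Variables (y : 'rV[R]_4) (uE : e y \in unitmx).
Let E := e y.
Let F := invmx E.

Definition frame_torsion : 'I_4 -> 'I_4 -> 'I_4 -> R :=
  slot1 (eta R) (slot2 F^T (slot3 F^T (torsion e w y))).
Definition frame_contortion := contortion_of frame_torsion.

Lemma torsionN a b c : torsion e w y a b c = - torsion e w y a c b.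
Proof. by rewrite /torsion opprB. Qed.

Lemma frame_torsionN a b c : frame_torsion a b c = - frame_torsion a c b.
Proof.
rewrite /frame_torsion !slot1_eta -mulrN; congr (_ * _).
rewrite /slot2 /slot3 -sumrN.
under eq_bigr do rewrite big_distrr/=.
under [RHS]eq_bigr do rewrite -mulrN -sumrN big_distrr/=.
rewrite exchange_big/=; apply: eq_bigr => l _; apply: eq_bigr => m _.
by rewrite torsionN; ring.
Qed.

Lemma frame_contortionN a b c : frame_contortion a b c = - frame_contortion b a c.
Proof. exact: contortion_ofN frame_torsionN. Qed.

Lemma frame_contortion_diag a c : frame_contortion a a c = 0.
Proof. exact: contortion_of_diag frame_torsionN. Qed.

Lemma torsion_of_frame_contortion : torsion_of frame_contortion = frame_torsion.
Proof. exact: torsion_of_contortion_of frame_torsionN. Qed.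

Lemma torsionE : torsion e w y = slot1 (eta R) (slot2 E^T (slot3 E^T frame_torsion)).
Proof.
rewrite /frame_torsion -!slot13C -!slot12C slot1M etaK slot1_1.
by rewrite -!slot23C slot2M slot3M FETr// slot2_1 slot3_1.
Qed.

Lemma torsion_lowE : torsion_low e w y = pull E frame_torsion.
Proof.
have -> : torsion_low e w y = slot1 (metric E) (slot1 F (torsion e w y)) by [].
by rewrite slot1M metric_F// torsionE slot1M -mulmxA etaK mulmx1.
Qed.

Lemma contortionE : contortion e w y = pull E frame_contortion.
Proof.
by apply: ext3 => i j k; rewrite pull_contortion_of /contortion torsion_lowE.
Qed.

Lemma contortion_upE mu nu rho : contortion_up e w y mu nu rho =
  slot1 (F *m eta R) (slot2 (F *m eta R) (slot3 E^T frame_contortion)) mu nu rho.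
Proof.
have -> : contortion_up e w y mu nu rho =
    slot1 (metric_inv E) (slot2 (metric_inv E) (contortion e w y)) mu nu rho.
  rewrite /slot1 /slot2; apply: eq_bigr => s _; rewrite big_distrr/=.
  by apply: eq_bigr => l _; rewrite mulrA.
rewrite contortionE /pull -!slot12C slot1M slot2M metric_inv_ET//.
Qed.

Lemma torsion_coordE : torsion_coord e w y =
  slot1 (F *m eta R) (slot2 E^T (slot3 E^T frame_torsion)).
Proof.
have -> : torsion_coord e w y = slot1 F (torsion e w y) by [].
by rewrite torsionE slot1M.
Qed.

Lemma FetaE i j : (F *m eta R) i j = F i j * sg4 j.
Proof. by rewrite mxE; under eq_bigr do rewrite -eta_tr mxE mulrC; rewrite sum_eta
  mulrC. Qed.

Lemma FTE_delta a c : \sum_(rho < 4) F rho a * E c rho = delta4 c a.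
Proof.
have /matrixP/(_ c a) := EF uE; rewrite !mxE /delta4 => <-.
by apply: eq_bigr => l _; rewrite mulrC.
Qed.

Lemma torsion_traceE mu : torsion_trace e w y mu = \sum_(b < 4) E b mu * torsion_vector
  frame_contortion b.
Proof.
rewrite /torsion_trace torsion_coordE.
under eq_bigr do rewrite slot_sum.
rewrite exchange_big/=.
under eq_bigr do rewrite exchange_big/=.
rewrite exchange_big/=; apply: eq_bigr => b _.
rewrite /torsion_vector big_distrr/=; apply: eq_bigr => a _.
rewrite exchange_big/=.
transitivity (\sum_(n < 4) (n == a)%:R * (sg4 a * E b mu * frame_torsion a b n)).
  apply: eq_bigr => n _; rewrite -/(delta4 n a) -FTE_delta big_distrl/=.
  by apply: eq_bigr => l _; rewrite FetaE !mxE; ring.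
under eq_bigr do rewrite eq_sym.
rewrite sum_delta -torsion_of_frame_contortion /torsion_of -[frame_contortion a a
  b]/(frame_contortion a a b) frame_contortion_diag subr0.
by ring.
Qed.

Lemma torsion_trace_upE mu :
  torsion_trace_up e w y mu = \sum_(b < 4) F mu b * (sg4 b * torsion_vector
    frame_contortion b).
Proof.
rewrite /torsion_trace_up.
under eq_bigr do rewrite torsion_traceE big_distrr/=.
rewrite exchange_big/=; apply: eq_bigr => b _.
have h : \sum_(nu < 4) metric_inv E mu nu * E b nu = F mu b * sg4 b.
  rewrite -FetaE -metric_inv_ET// mxE; apply: eq_bigr => l _.
  by rewrite mxE.
by rewrite [RHS]mulrA -h big_distrl/=; apply: eq_bigr => l _; rewrite mulrA.
Qed.

(** Contracting [S_rho^{mu nu}] with [e_a^rho] undoes the coframe in the last slot of the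
    contortion, so only the two upper indices still carry inverse coframes. *)
Lemma momentumE kappa a mu nu : momentum kappa e w y a mu nu =
  - (2 * vol E / kappa ^+ 2) *
  \sum_(b < 4) \sum_(c < 4) F mu b * F nu c * superpot_up frame_contortion a b c.
Proof.
rewrite /momentum; congr (_ * _).
have h1 : \sum_(rho < 4) F rho a * contortion_up e w y mu nu rho =
    \sum_(b < 4) \sum_(c < 4) F mu b * F nu c * (sg4 b * sg4 c * frame_contortion b c
      a).
  transitivity (slot3 F^T (slot1 (F *m eta R) (slot2 (F *m eta R)
      (slot3 E^T frame_contortion))) mu nu a).
    by apply: eq_bigr => r _; rewrite contortion_upE mxE.
  rewrite -slot13C -slot23C slot3M EFTr// slot3_1 /slot1 /slot2.
  apply: eq_bigr => b _; rewrite big_distrr/=; apply: eq_bigr => c _.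
  by rewrite !FetaE; ring.
have h2 rho : \sum_(s < 4) F s a * kron R rho s = F rho a.
  rewrite -(sum_delta (fun s => F s a) rho); apply: eq_bigr => s _.
  by rewrite /kron mulrC.
transitivity (- (\sum_(rho < 4) F rho a * contortion_up e w y mu nu rho)
   + torsion_trace_up e w y mu * (\sum_(s < 4) F s a * kron R nu s)
   - torsion_trace_up e w y nu * (\sum_(s < 4) F s a * kron R mu s)).
  rewrite !big_distrr/= -sumrN -big_split/= -sumrB; apply: eq_bigr => r _.
  by rewrite /superpotential; ring.
rewrite h1 !h2 !torsion_trace_upE.
have h3 nu' : F nu' a = \sum_(c < 4) F nu' c * delta4 c a.
  rewrite -(sum_delta (fun c => F nu' c) a); apply: eq_bigr => c _.
  by rewrite /delta4 mulrC eq_sym.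
rewrite [in F nu a]h3 [in F mu a]h3.
rewrite /superpot_up /superpot; move: (torsion_vector frame_contortion) => C.
rewrite [X in _ - X]mulrC !big_distrl/= -sumrN -big_split/= -sumrB.
apply: eq_bigr => b _; rewrite !big_distrr/= -sumrN -big_split/= -sumrB.
apply: eq_bigr => c _.
have b2 := sg4K (R := R) b; have c2 := sg4K (R := R) c.
(* [superpot] has all indices lowered, hence [sg4] next to each delta; raising the indices leaves
   squares of [sg4], which are 1. *)
transitivity (- (F mu b * F nu c * (sg4 b * sg4 c * frame_contortion b c a))
  + F mu b * (sg4 b * C b) * (F nu c * delta4 c a) * (sg4 c * sg4 c)
  - F mu b * delta4 b a * (F nu c * (sg4 c * C c)) * (sg4 b * sg4 b)).
  by rewrite b2 c2 !mulr1.
by ring.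
Qed.

End AtAPoint.
End FrameTensors.

(** * The flat connection and the Levi-Civita connection *)

Section LocalFields.
Context {R : realType}.
Local Notation dir mu := (delta_mx ord0 mu : 'rV[R]_4).

(** The chart-level data of the pointwise argument: curvature takes two derivatives of the coframe,
    Schwarz's theorem takes continuity of the second ones, and flatness takes one derivative of the
    spin connection. *)
Record local_fields (e : 'rV[R]_4 -> 'M[R]_4) (w : 'rV[R]_4 -> 'I_4 -> 'M[R]_4)
    (U : set 'rV[R]_4) : Prop := LocalFields {
  fields_open : open U;
  coframe_unit : forall y, U y -> e y \in unitmx;
  coframe_cont : forall y i j, U y -> {for y, continuous (fun z => e z i j)};
  coframe_der : forall y mu i j, U y -> derivable (fun z => e z i j) y (dir mu);
  coframe_der2 : forall y mu nu i j, U y ->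
    derivable (partial nu (fun z => e z i j)) y (dir mu);
  coframe_cont2 : forall y mu nu i j, U y ->
    {for y, continuous (partial mu (partial nu (fun z => e z i j)))};
  spin_der : forall y mu nu i j, U y -> derivable (fun z => w z nu i j) y (dir mu);
  spin_compat : forall y, U y -> metric_compatible (w y);
  spin_flat : forall y mu nu a b, U y -> spin_curvature w y mu nu a b = 0 }.
End LocalFields.

Section LocalGeometry.
Context {R : realType}.
Variables (e : 'rV[R]_4 -> 'M[R]_4) (w : 'rV[R]_4 -> 'I_4 -> 'M[R]_4).
Local Notation dir mu := (delta_mx ord0 mu : 'rV[R]_4).
Variables (U : set 'rV[R]_4) (H : local_fields e w U).

Definition dE nu y : 'M[R]_4 := \matrix_(a, m) partial nu (fun z => e z a m) y.
Definition DE nu y : 'M[R]_4 := dE nu y + w y nu *m e y.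
(* The flat (Weitzenboeck) connection: [flat_conn nu y rho mu] is e_a^rho D_nu e^a_mu.
  *)
Definition flat_conn nu y : 'M[R]_4 := invmx (e y) *m DE nu y.
(** [K^a_{bc}] as a matrix in [a], [b]; [KK mu] is then the contortion as a matrix-valued
    one-form. *)
Definition kmx y c : 'M[R]_4 := \matrix_(a, b) (sg4 a * frame_contortion e w y a b c).
Definition KK mu y : 'M[R]_4 := \sum_(c < 4) e y c mu *: kmx y c.

Lemma covD_coframeE y nu a m : covD_coframe e w y nu a m = DE nu y a m.
Proof. by rewrite !mxE. Qed.

Lemma torsion_coord_flat_conn y rho mu nu :
  torsion_coord e w y rho mu nu = flat_conn nu y rho mu - flat_conn mu y rho nu.
Proof.
rewrite !mxE -sumrB; apply: eq_bigr => a _.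
by rewrite /torsion !covD_coframeE mulrBr.
Qed.

Section AtPoint.
Variables (y : 'rV[R]_4) (Uy : U y).
Let E := e y.
Let F := invmx E.
Let uE : E \in unitmx := coframe_unit H Uy.

Lemma near_U : \near y, U y.
Proof. exact: open_nbhs_nbhs (conj (fields_open H) Uy). Qed.

Lemma E_flat_conn nu : E *m flat_conn nu y = DE nu y.
Proof. by rewrite mulKVmx. Qed.

(** The coframe is parallel for the pair of connections; every derivative of [e] is eliminated
    through this equation. *)
Lemma dE_flat_conn nu : dE nu y = E *m flat_conn nu y - w y nu *m E.
Proof. by rewrite E_flat_conn addrK. Qed.

Lemma F_dE nu : F *m dE nu y = flat_conn nu y - F *m w y nu *m E.
Proof. by rewrite dE_flat_conn mulmxBr mulKmx// mulmxA. Qed.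

Lemma w_eta nu : (w y nu)^T *m eta R = - (eta R *m w y nu).
Proof.
rewrite -[X in _ *m X]eta_tr -trmx_mul; apply/matrixP => a b.
by rewrite [LHS]mxE [RHS]mxE; exact: (spin_compat H Uy).
Qed.

Lemma is_derive_e mu : is_derive_mx y (dir mu) e (dE mu y).
Proof. by move=> i j; rewrite mxE; apply: derivableP; exact: (coframe_der H). Qed.

Lemma is_derive_F mu :
  is_derive_mx y (dir mu) (fun z => invmx (e z)) (- (F *m dE mu y *m F)).
Proof.
apply: is_derive_invmx => //; last exact: is_derive_e.
by move=> i j; exact: (coframe_cont H).
Qed.

(** [flat_conn] is metric: the spin connection terms cancel because [w] is antisymmetric with
    respect to [eta]. *)
Lemma is_derive_metric nu : is_derive_mx y (dir nu) (fun z => metric (e z))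
  ((flat_conn nu y)^T *m metric E + metric E *m flat_conn nu y).
Proof.
have h := is_derive_mxM (is_derive_mxM (is_derive_mx_tr (is_derive_e nu))
  (is_derive_mx_cst y (dir nu) (eta R))) (is_derive_e nu).
have -> : (fun z => metric (e z)) = (fun z => (e z)^T *m eta R *m e z).
  by apply/funext => z; rewrite metricE.
apply: is_derive_mx_eq h _.
rewrite mulmx0 addr0 dE_flat_conn -/E metricE linearB/= !trmx_mul mulmxBr !mulmxBl.
rewrite -[E^T *m (w y nu)^T *m eta R]mulmxA w_eta mulmxN mulNmx opprK !mulmxA.
by rewrite addrACA subrr addr0.
Qed.

(** Metricity turns each derivative of [g] into a symmetrized [g L]. The Christoffel combination of
    these is one [g L] plus antisymmetrized remainders, which are the three torsions of the
    contortion with the direction [mu] in its last slot. *)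
Lemma christoffelE rho mu nu :
  christoffel e y rho mu nu = (flat_conn mu y + F *m KK mu y *m E) rho nu.
Proof.
have dg s l k : partial k (fun z => metric (e z) s l) y =
    (metric E *m flat_conn k y) l s + (metric E *m flat_conn k y) s l.
  rewrite /partial (@derive_val _ _ _ _ _ _ _ (is_derive_metric k s l)).
  by rewrite mxE -[metric E in LHS]metric_tr -trmx_mul mxE metric_tr.
have tl s l k : torsion_low e w y s l k =
    (metric E *m flat_conn k y) s l - (metric E *m flat_conn l y) s k.
  rewrite !mxE -sumrB; apply: eq_bigr => r _.
  by rewrite torsion_coord_flat_conn mulrBr.
rewrite /christoffel big_distrr/=.
transitivity (\sum_(s < 4) metric_inv E rho s *
    ((metric E *m flat_conn mu y) s nu + contortion e w y s nu mu)).
  by apply: eq_bigr => s _; rewrite !dg /contortion !tl -/E; field.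
under eq_bigr do rewrite mulrDr.
rewrite big_split/= [RHS]mxE; congr (_ + _).
  by rewrite -[flat_conn mu y in RHS]mul1mx -(metric_invK uE) -mulmxA mxE.
rewrite contortionE//.
transitivity (slot1 (F *m eta R) (slot2 E^T (slot3 E^T (frame_contortion e w y))) rho
  nu mu).
  by rewrite -(metric_inv_ET uE) -slot1M.
rewrite slot_sum [RHS]mxE.
under [RHS]eq_bigr do rewrite mxE big_distrl/=.
rewrite [RHS]exchange_big/=; apply: eq_bigr => a _; apply: eq_bigr => b _.
rewrite /KK summxE big_distrr/= big_distrl/=; apply: eq_bigr => c _.
by rewrite FetaE !mxE; ring.
Qed.

End AtPoint.
End LocalGeometry.

(** * Second derivatives of the coframe and vanishing curvature of [flat_conn] *)

Section Curvature.
Context {R : realType}.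
Variables (e : 'rV[R]_4 -> 'M[R]_4) (w : 'rV[R]_4 -> 'I_4 -> 'M[R]_4).
Variables (U : set 'rV[R]_4) (H : local_fields e w U).
Local Notation dir mu := (delta_mx ord0 mu : 'rV[R]_4).
Local Notation k := (frame_contortion e w).

Lemma derivable_mulf (f g : 'rV[R]_4 -> R) x v : derivable f x v ->
  derivable g x v -> derivable (fun y => f y * g y) x v.
Proof. by move=> /derivableP hf /derivableP hg; case: (is_derive_scalar_mul hf hg). Qed.

Lemma derivable_sumf n (f : 'I_n -> 'rV[R]_4 -> R) x v :
  (forall i, derivable (f i) x v) -> derivable (fun y => \sum_(i < n) f i y) x v.
Proof.
by move=> hf; case: (is_derive_scalar_sum (fun i => derivableP (hf i))).
Qed.

Lemma derivable_scalef (f : 'rV[R]_4 -> R) (c : R) x v : derivable f x v ->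
  derivable (fun y => c * f y) x v.
Proof. by apply: derivable_mulf; exact: derivable_cst. Qed.

Lemma derivable_slot (A B C : 'rV[R]_4 -> 'M[R]_4)
    (t : 'rV[R]_4 -> 'I_4 -> 'I_4 -> 'I_4 -> R) x v i j l :
  (forall i j, derivable (fun y => A y i j) x v) ->
  (forall i j, derivable (fun y => B y i j) x v) ->
  (forall i j, derivable (fun y => C y i j) x v) ->
  (forall i j l, derivable (fun y => t y i j l) x v) ->
  derivable (fun y => slot1 (A y) (slot2 (B y) (slot3 (C y) (t y))) i j l) x v.
Proof.
move=> hA hB hC ht; rewrite (_ : (fun y => _) = fun y =>
  \sum_(l' < 4) \sum_(m < 4) \sum_(n < 4) A y i l' * B y j m * C y l n * t y l' m n).
  do 3 (apply: derivable_sumf => ?); do 3 (apply: derivable_mulf => //).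
by apply/funext => y; rewrite slot_sum.
Qed.

Lemma mxE_add m n (A B : 'M[R]_(m, n)) i j : (A + B) i j = A i j + B i j.
Proof. by rewrite mxE. Qed.
Lemma mxE_opp m n (A : 'M[R]_(m, n)) i j : (- A) i j = - A i j.
Proof. by rewrite mxE. Qed.

Lemma mxE_scale m n (r : R) (A : 'M[R]_(m, n)) i j : (r *: A) i j = r * A i j.
Proof. by rewrite mxE. Qed.
Lemma mxE_tr m n (A : 'M[R]_(m, n)) i j : A^T i j = A j i.
Proof. by rewrite mxE. Qed.

Section AtPoint.
Variables (x : 'rV[R]_4) (Ux : U x).
Let E := e x.
Let F := invmx E.
Let uE : E \in unitmx := coframe_unit H Ux.
Local Notation L nu := (flat_conn e w nu x).
Local Notation om nu := (w x nu).

Definition d2E mu nu : 'M[R]_4 :=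
  \matrix_(i, j) partial mu (partial nu (fun z => e z i j)) x.
Definition dw mu nu : 'M[R]_4 := \matrix_(i, j) partial mu (fun z => w z nu i j) x.
Definition dk mu a b c := partial mu (fun y => k y a b c) x.

Lemma d2E_sym mu nu : d2E mu nu = d2E nu mu.
Proof.
apply/matrixP => i j; rewrite [LHS]mxE [RHS]mxE.
apply: (@schwarz _ _ (fun z => e z i j) x (dir nu) (dir mu) U (fields_open H) Ux)
  => [y Uy||]; last 2 first.
- exact: (coframe_cont2 H).
- exact: (coframe_cont2 H).
by split; [exact: (coframe_der H)|exact: (coframe_der H)
  |exact: (coframe_der2 H)|exact: (coframe_der2 H)].
Qed.

Lemma is_derive_dE mu nu : is_derive_mx x (dir mu) (dE e nu) (d2E mu nu).
Proof.
move=> i j; have -> : (fun y => dE e nu y i j) = partial nu (fun z => e z i j).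
  by apply/funext => y; rewrite mxE.
by rewrite mxE; apply: derivableP; exact: (coframe_der2 H).
Qed.

Lemma is_derive_w mu nu : is_derive_mx x (dir mu) (fun z => w z nu) (dw mu nu).
Proof. by move=> i j; rewrite mxE; apply: derivableP; exact: (spin_der H). Qed.

Lemma is_derive_DE mu nu : is_derive_mx x (dir mu) (DE e w nu)
  (d2E mu nu + (dw mu nu *m E + om nu *m dE e mu x)).
Proof.
apply: is_derive_mxD; first exact: is_derive_dE.
exact: is_derive_mxM (is_derive_w _ _) (is_derive_e H Ux _).
Qed.

Lemma derivable_k mu a b c : derivable (fun y => k y a b c) x (dir mu).
Proof.
have hF i j : derivable (fun y => ((invmx (e y))^T) i j) x (dir mu).
  by have [+ _] := is_derive_mx_tr (is_derive_F H Ux mu) i j.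
have hT a' b' c' : derivable (fun y => torsion e w y a' b' c') x (dir mu).
  rewrite (_ : (fun y => _) = fun y => DE e w c' y a' b' + - DE e w b' y a' c').
    have [+ _] := is_derive_scalar_add (is_derive_DE mu c' a' b')
      (is_derive_scalar_opp (is_derive_DE mu b' a' c')).
    by [].
  by apply/funext => y; rewrite /torsion !covD_coframeE.
have ht a' b' c' : derivable (fun y => frame_torsion e w y a' b' c') x (dir mu).
  by apply: (derivable_slot (A := fun=> eta R)) => // i j; exact: derivable_cst.
apply: derivable_scalef.
by apply: derivableB => //; exact: derivableD.
Qed.

Lemma is_derive_k mu a b c : is_derive x (dir mu) (fun y => k y a b c) (dk mu a b c).
Proof. by apply: derivableP; exact: derivable_k. Qed.

(** Arranged by symmetry in [a], [b]: the two terms mixing [w] and [L] are exchanged and the second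
    derivative of [e] is symmetric, so antisymmetrizing leaves the commutator of [L] and the
    curvature of [w]. *)
Lemma is_derive_flat_conn a b : is_derive_mx x (dir a) (flat_conn e w b)
  (- (L a *m L b) + F *m om a *m E *m L b + F *m om b *m E *m L a
    + F *m d2E a b + F *m (dw a b - om b *m om a) *m E).
Proof.
apply: is_derive_mx_eq (is_derive_mxM (is_derive_F H Ux a) (is_derive_DE a b)) _.
rewrite -/E -/F mulNmx -[_ *m F *m DE e w b x]mulmxA -/(L b) (F_dE H Ux) (dE_flat_conn
  H Ux).
rewrite -/E -/F; move: (L a) (L b) => La Lb.
rewrite !(mulmxDl, mulmxDr, mulNmx, mulmxN) !mulmxA.
set m1 := La *m Lb; set m2 := _ *m Lb; set m3 := F *m d2E a b.
set m4 := _ *m dw a b *m E; set m5 := _ *m La; set m6 := _ *m E.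
by apply/matrixP => i j; rewrite !(mxE_add, mxE_opp); ring.
Qed.

(** The two derivatives are left abstract, since only their difference has a simple form. *)
Lemma flat_conn_curvature0 mu nu : exists dLmn dLnm,
  [/\ is_derive_mx x (dir mu) (flat_conn e w nu) dLmn,
      is_derive_mx x (dir nu) (flat_conn e w mu) dLnm
    & dLmn - dLnm = L nu *m L mu - L mu *m L nu].
Proof.
do 2 eexists; split; [exact: is_derive_flat_conn|exact: is_derive_flat_conn|].
have flat : dw mu nu - om nu *m om mu = dw nu mu - om mu *m om nu.
  apply/matrixP => a b; have /eqP := spin_flat H mu nu a b Ux.
  rewrite /spin_curvature !mxE => /eqP h; apply: subr0_eq; apply: etrans h; ring.
rewrite flat d2E_sym.
set m1 := L mu *m L nu; set m2 := L nu *m L mu; set m3 := F *m d2E _ _.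
set m4 := _ *m L nu; set m5 := _ *m L mu; set m6 := _ *m E.
by apply/matrixP => i j; rewrite !(mxE_add, mxE_opp); ring.
Qed.
End AtPoint.
End Curvature.

(** * Curvature *)

Section FrameCurvature.
Context {R : realType}.
Variables (e : 'rV[R]_4 -> 'M[R]_4) (w : 'rV[R]_4 -> 'I_4 -> 'M[R]_4).
Variables (U : set 'rV[R]_4) (H : local_fields e w U).
Local Notation dir mu := (delta_mx ord0 mu : 'rV[R]_4).
Variables (x : 'rV[R]_4) (Ux : U x).
Let E := e x.
Let F := invmx E.
Let uE : E \in unitmx := coframe_unit H Ux.
Local Notation L nu := (flat_conn e w nu x).
Local Notation om nu := (w x nu).
Local Notation k := (frame_contortion e w x).
Local Notation dk := (dk e w x).

(* [mu] is a coordinate index, the other three are lower frame indices. *)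
Definition cov3 mu a b c := dk mu a b c
  - \sum_(l < 4) (om mu l a * k l b c + om mu l b * k a l c + om mu l c * k a b l).
Definition frame_dcontortion d a b c := \sum_(mu < 4) F mu d * cov3 mu a b c.

Lemma om_sg mu a b : sg4 a * om mu a b = - (sg4 b * om mu b a).
Proof.
have := spin_compat H Ux mu a b.
by rewrite !mxE !(sum_eta (fun j => om mu j _)).
Qed.

Lemma dkN mu a b c : dk mu a b c = - dk mu b a c.
Proof.
rewrite -(@derive_val _ _ _ _ _ _ _ (is_derive_k H Ux mu a b c)).
rewrite (_ : (fun y => _) = fun y => - frame_contortion e w y b a c).
  have := is_derive_scalar_opp (is_derive_k H Ux mu b a c).
  by move=> /(@derive_val _ _ _ _ _ _ _).
by apply/funext => y; exact: frame_contortionN.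
Qed.

Lemma cov3N mu a b c : cov3 mu a b c = - cov3 mu b a c.
Proof.
rewrite /cov3 dkN opprB addrC; congr (_ - _); rewrite -sumrN.
by apply: eq_bigr => l _; rewrite (frame_contortionN _ _ _ l b) (frame_contortionN _ _
  _ a l)
  (frame_contortionN _ _ _ a b); ring.
Qed.

Lemma self_opp0 (r : R) : r = - r -> r = 0.
Proof. by move/eqP; rewrite -subr_eq0 opprK -mulr2n mulrn_eq0/= => /eqP. Qed.

Lemma frame_dcontortionN d a b c : frame_dcontortion d a b c = - frame_dcontortion d b
  a c.
Proof. by rewrite /frame_dcontortion -sumrN; apply: eq_bigr => l _; rewrite cov3N
  mulrN. Qed.

Lemma frame_dcontortion_diag d a c : frame_dcontortion d a a c = 0.
Proof. exact/self_opp0/frame_dcontortionN. Qed.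

Lemma FE_delta a c : \sum_(d < 4) F a d * E d c = (a == c)%:R.
Proof. by have /matrixP/(_ a c) := FE uE; rewrite !mxE. Qed.

Lemma cov3_frame_dcontortion mu a b c : cov3 mu a b c = \sum_(d < 4) E d mu *
  frame_dcontortion d a b c.
Proof.
rewrite -(sum_delta (fun l => cov3 l a b c) mu).
under [RHS]eq_bigr do rewrite big_distrr/=.
rewrite exchange_big/=; apply: eq_bigr => l _.
rewrite eq_sym -FE_delta big_distrl/=; apply: eq_bigr => d _.
by rewrite mulrA [F _ _ * _]mulrC.
Qed.

Definition dkm mu c : 'M[R]_4 := \matrix_(a, b) (sg4 a * dk mu a b c).
Definition dKK mu nu : 'M[R]_4 :=
  \sum_(c < 4) (dE e mu x c nu *: kmx e w x c + E c nu *: dkm mu c).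
Definition DKK mu nu := dKK mu nu + om mu *m KK e w nu x - KK e w nu x *m om mu.
(** For flat [w], the curvature of the Lorentz connection [w + KK]. *)
Definition RR mu nu := DKK mu nu - DKK nu mu
  + KK e w mu x *m KK e w nu x - KK e w nu x *m KK e w mu x.

Lemma is_derive_KK mu nu : is_derive_mx x (dir mu) (KK e w nu) (dKK mu nu).
Proof.
apply: is_derive_mx_sum => c; apply: is_derive_mx_scale; first exact: (is_derive_e H Ux
  mu c nu).
move=> a b; rewrite mxE (_ : (fun y => _) = fun y => sg4 a * frame_contortion e w y a b
  c).
  apply: is_derive_eq (is_derive_scalar_mul (is_derive_cst (sg4 a : R) x (dir mu))
    (is_derive_k H Ux mu a b c)) _.
  by rewrite mul0r add0r.
by apply/funext => y; rewrite mxE.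
Qed.

Definition XX mu y := invmx (e y) *m KK e w mu y *m e y.

(** Conjugation by the parallel coframe intertwines the connections: the covariant derivative of
    [XX] by [L] is the conjugate of the covariant derivative of [KK] by [w]. *)
Lemma is_derive_XX mu nu : is_derive_mx x (dir mu) (XX nu)
  (- (L mu *m XX nu x) + XX nu x *m L mu + F *m DKK mu nu *m E).
Proof.
apply: is_derive_mx_eq (is_derive_mxM (is_derive_mxM (is_derive_F H Ux mu)
  (is_derive_KK mu nu)) (is_derive_e H Ux mu)) _.
rewrite (F_dE H Ux) (dE_flat_conn H Ux) -/E -/F /XX -/E -/F /DKK.
move: (L mu) => La; move: (KK e w nu x) => Kn; move: (om mu) (dKK mu nu) => o dK.
rewrite !(mulmxDl, mulmxDr, mulNmx, mulmxN) !mulmxA.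
rewrite -[_ *m E *m F](mulmxA _ E F) EF// mulmx1.
set m1 := La *m _ *m _ *m _; set m2 := _ *m La; set m3 := _ *m dK *m E.
set m4 := F *m o *m Kn *m E; set m5 := F *m Kn *m o *m E.
by apply/matrixP => i j; rewrite !(mxE_add, mxE_opp); ring.
Qed.

Lemma christoffel_sym y rho mu nu : christoffel e y rho mu nu = christoffel e y rho nu
  mu.
Proof.
rewrite /christoffel; congr (_ * _); apply: eq_bigr => s _; congr (_ * (_ - _)).
  by rewrite addrC.
congr (partial _ _ _); apply/funext => z; by rewrite -[in LHS]metric_tr mxE.
Qed.

(** Curvature of [L + XX]. The commutator of [L] cancels by flatness and the mixed products cancel
    against the derivative of [XX]; what remains is conjugate to [RR]. *)
Lemma riemannE rho sigma mu nu :
  riemann e x rho sigma mu nu = (F *m RR mu nu *m E) rho sigma.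
Proof.
have [dmn [dnm [h1 h2 flat]]] := flat_conn_curvature0 H Ux mu nu.
have dchr a b dL : is_derive_mx x (dir a) (flat_conn e w b) dL ->
    partial a (fun y => christoffel e y rho sigma b) x =
    (dL + (- (L a *m XX b x) + XX b x *m L a + F *m DKK a b *m E)) rho sigma.
  move=> hL; have := is_derive_mxD hL (is_derive_XX a b) rho sigma.
  move=> /(@derive_val _ _ _ _ _ _ _) <-; rewrite /partial; apply: near_eq_derive.
  near=> y; have Uy : U y by near: y; exact: (near_U H Ux).
  (* [riemann] has the direction of the connection as last lower index, [christoffelE] as first;
     symmetry of the Christoffel symbols exchanges them. *)
  by rewrite christoffel_sym (christoffelE H Uy).
have chr r m n : christoffel e x r m n = (L m + XX m x) r n.
  by rewrite (christoffelE H Ux).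
rewrite /riemann (dchr _ _ _ h1) (dchr _ _ _ h2).
have -> : \sum_(l < 4) christoffel e x rho l mu * christoffel e x l sigma nu =
    ((L mu + XX mu x) *m (L nu + XX nu x)) rho sigma.
  rewrite mxE; apply: eq_bigr => l _.
  by rewrite christoffel_sym [christoffel e x l _ _]christoffel_sym !chr.
have -> : \sum_(l < 4) christoffel e x rho l nu * christoffel e x l sigma mu =
    ((L nu + XX nu x) *m (L mu + XX mu x)) rho sigma.
  rewrite mxE; apply: eq_bigr => l _.
  by rewrite christoffel_sym [christoffel e x l _ _]christoffel_sym !chr.
have XXM a b : XX a x *m XX b x = F *m (KK e w a x *m KK e w b x) *m E.
  by rewrite /XX !mulmxA -[_ *m e x *m invmx (e x)](mulmxA _ E F) EF// mulmx1.
rewrite /RR; move: (DKK mu nu) (DKK nu mu) => D1 D2.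
have {flat} : dmn = dnm + (L nu *m L mu - L mu *m L nu) by rewrite -flat addrC subrK.
move=> ->; move: (XX mu x) (XX nu x) (XXM mu nu) (XXM nu mu) => Xa Xb Xab Xba.
move: (KK e w mu x) (KK e w nu x) Xab Xba => Ka Kb Xab Xba.
move: (L mu) (L nu) => La Lb.
rewrite !(mulmxDl, mulmxDr, mulNmx, mulmxN) Xab Xba.
rewrite -!mxE_opp -!mxE_add; congr (fun_of_matrix _ _ _).
move: (La *m Lb) (Lb *m La) (La *m Xb) (Xb *m La) (Lb *m Xa) (Xa *m Lb) => a1 a2 a3 a4
  a5 a6.
move: (F *m D1 *m E) (F *m D2 *m E) => b1 b2.
move: (F *m (Ka *m Kb) *m E) (F *m (Kb *m Ka) *m E) => c1 c2.
by apply/matrixP => i j; rewrite !(mxE_add, mxE_opp); ring.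
Unshelve. all: by end_near. Qed.
End FrameCurvature.

(** * Ricci and Einstein tensors in the frame *)

Section FrameRicci.
Context {R : realType}.
Variables (e : 'rV[R]_4 -> 'M[R]_4) (w : 'rV[R]_4 -> 'I_4 -> 'M[R]_4).
Variables (U : set 'rV[R]_4) (H : local_fields e w U).
Local Notation dir mu := (delta_mx ord0 mu : 'rV[R]_4).
Variables (x : 'rV[R]_4) (Ux : U x).
Let E := e x.
Let F := invmx E.
Let uE : E \in unitmx := coframe_unit H Ux.
Local Notation L nu := (flat_conn e w nu x).
Local Notation om nu := (w x nu).
Local Notation k := (frame_contortion e w x).
Local Notation dk := (dk e w x).
Local Notation cov3 := (cov3 e w x).
Local Notation frame_dcontortion := (frame_dcontortion e w x).
Local Notation RR := (RR e w x).
Local Notation DKK := (DKK e w x).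

Lemma om_sgr mu a l : om mu a l * sg4 l = - (sg4 a * om mu l a).
Proof.
transitivity (sg4 a * sg4 l * (sg4 a * om mu a l)).
  by rewrite -[LHS]mul1r -(sg4K a); ring.
by rewrite (om_sg H Ux) -[RHS]mul1r -(sg4K l); ring.
Qed.

(** The commutator with [w] makes the derivative covariant in the two matrix indices. The missing
    term for the third index is subtracted from the derivative of [k] and added back to that of the
    coframe, so that [dE] becomes [DE]. *)
Lemma DKKE mu nu a b : DKK mu nu a b = sg4 a *
  \sum_(c < 4) (E c nu * cov3 mu a b c + DE e w mu x c nu * k a b c).
Proof.
have h1 : (om mu *m KK e w nu x) a b =
    - \sum_(c < 4) \sum_(l < 4) sg4 a * E c nu * (om mu l a * k l b c).
  rewrite mxE -sumrN.
  under eq_bigr do rewrite summxE big_distrr/=.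
  rewrite exchange_big/=; apply: eq_bigr => c _; rewrite -sumrN.
  apply: eq_bigr => l _; rewrite !mxE.
  transitivity (E c nu * k l b c * (om mu a l * sg4 l)); first by ring.
  by rewrite om_sgr; ring.
have h2 : (KK e w nu x *m om mu) a b =
    \sum_(c < 4) \sum_(l < 4) sg4 a * E c nu * (om mu l b * k a l c).
  rewrite mxE; under eq_bigr do rewrite summxE big_distrl/=.
  rewrite exchange_big/=; apply: eq_bigr => c _.
  by apply: eq_bigr => l _; rewrite !mxE; ring.
have h3 : \sum_(c < 4) \sum_(l < 4) sg4 a * E c nu * (om mu l c * k a b l) =
    \sum_(c < 4) \sum_(l < 4) sg4 a * (om mu c l * E l nu * k a b c).
  rewrite exchange_big/=; apply: eq_bigr => c _; apply: eq_bigr => l _; ring.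
rewrite /DKK mxE_add mxE_opp mxE_add h1 h2.
transitivity (\sum_(c < 4) (sg4 a * (dE e mu x c nu * k a b c + E c nu * dk mu a b c))
  - \sum_(c < 4) \sum_(l < 4) sg4 a * E c nu * (om mu l a * k l b c)
  - \sum_(c < 4) \sum_(l < 4) sg4 a * E c nu * (om mu l b * k a l c)
  - \sum_(c < 4) \sum_(l < 4) sg4 a * E c nu * (om mu l c * k a b l)
  + \sum_(c < 4) \sum_(l < 4) sg4 a * (om mu c l * E l nu * k a b c)).
  rewrite h3 subrK; congr (_ - _ - _); rewrite summxE.
  by apply: eq_bigr => c _; rewrite !mxE; ring.
rewrite -!sumrB -big_split/= big_distrr/=; apply: eq_bigr => c _.
rewrite /cov3 [DE _ _ _ _ _ _]mxE_add [(_ *m _) _ _]mxE.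
rewrite -!big_distrr/= -big_distrl/= !big_split/=; ring.
Qed.

Lemma RRE mu nu a b : RR mu nu a b =
  \sum_(c < 4) \sum_(d < 4) E c mu * E d nu * frame_riemann k frame_dcontortion a b c d.
Proof.
have hD m n : DKK m n a b = sg4 a * (\sum_(c < 4) \sum_(d < 4)
    E c m * E d n * frame_dcontortion c a b d) + sg4 a * \sum_(c < 4) DE e w m x c n *
      k a b c.
  rewrite DKKE big_split/= mulrDr; congr (_ * _ + _).
  rewrite exchange_big/=; apply: eq_bigr => d _.
  rewrite (cov3_frame_dcontortion H Ux) big_distrr/=; apply: eq_bigr => c _; ring.
(* Antisymmetrizing [D_mu e^c_nu] gives minus the torsion, the source of the torsion term in
   [frame_riemann]. *)
have hT : \sum_(c < 4) DE e w mu x c nu * k a b c - \sum_(c < 4) DE e w nu x c mu * k a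
  b c =
    - \sum_(c < 4) \sum_(d < 4) E c mu * E d nu *
      \sum_(l < 4) k a b l * (sg4 l * torsion_of k l c d).
  have -> : \sum_(c < 4) \sum_(d < 4) E c mu * E d nu *
      (\sum_(l < 4) k a b l * (sg4 l * torsion_of k l c d)) =
      \sum_(l < 4) torsion e w x l mu nu * k a b l.
    rewrite (torsionE w uE) torsion_of_frame_contortion.
    under [RHS]eq_bigr do rewrite slot1_eta /slot2 /slot3 big_distrr big_distrl/=.
    rewrite [RHS]exchange_big/=; apply: eq_bigr => c _.
    under [RHS]eq_bigr do rewrite !big_distrr big_distrl/=.
    rewrite [RHS]exchange_big/=; apply: eq_bigr => d _.
    rewrite big_distrr/=; apply: eq_bigr => l _; rewrite !mxE; ring.
  rewrite -sumrB -sumrN; apply: eq_bigr => l _.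
  by rewrite /torsion !covD_coframeE; ring.
have hK m n : (KK e w m x *m KK e w n x) a b =
    \sum_(c < 4) \sum_(d < 4) E c m * E d n *
      \sum_(l < 4) sg4 a * k a l c * (sg4 l * k l b d).
  rewrite mxE.
  under eq_bigr do rewrite !summxE big_distrl/=.
  rewrite exchange_big/=; apply: eq_bigr => c _.
  under eq_bigr do rewrite big_distrr/=.
  rewrite exchange_big/=; apply: eq_bigr => d _.
  rewrite big_distrr/=; apply: eq_bigr => l _; rewrite !mxE; ring.
have swap (f : 'I_4 -> 'I_4 -> R) : \sum_(c < 4) \sum_(d < 4) E c nu * E d mu * f c d =
    \sum_(c < 4) \sum_(d < 4) E c mu * E d nu * f d c.
  by rewrite exchange_big/=; do 2 (apply: eq_bigr => ? _); ring.
have -> : RR mu nu a b = DKK mu nu a b - DKK nu mu a b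
    + (KK e w mu x *m KK e w nu x) a b - (KK e w nu x *m KK e w mu x) a b.
  by rewrite /RR; move: (DKK mu nu) (DKK nu mu) => D1 D2; rewrite !mxE.
rewrite !hK !hD swap [X in _ - X]swap.
move: hT; set T1 := \sum_c _ * k a b c; set T2 := \sum_c _ * k a b c => hT.
pose SS f : R := \sum_(c < 4) \sum_(d < 4) E c mu * E d nu * f c d.
have SSD f g : SS f + SS g = SS (fun c d => f c d + g c d).
  by rewrite /SS -big_split/=; apply: eq_bigr => c _; rewrite -big_split/=;
    apply: eq_bigr => d _; rewrite mulrDr.
have SSZ r f : r * SS f = SS (fun c d => r * f c d).
  by rewrite /SS big_distrr/=; apply: eq_bigr => c _; rewrite big_distrr/=;
    apply: eq_bigr => d _; rewrite mulrCA.
rewrite -![\sum_(c < 4) \sum_(d < 4) E c mu * E d nu * _]/(SS _).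
transitivity (sg4 a * SS (fun c d => frame_dcontortion c a b d) + (- sg4 a) * SS (fun c
  d => frame_dcontortion d a b c)
  + (- sg4 a) * SS (fun c d => \sum_(l < 4) k a b l * (sg4 l * torsion_of k l c d))
  + SS (fun c d => \sum_(l < 4) sg4 a * k a l c * (sg4 l * k l b d))
  + (- 1) * SS (fun c d => \sum_(l < 4) sg4 a * k a l d * (sg4 l * k l b c))).
  rewrite -[SS (fun c d => \sum_(l < 4) k a b l * _)]opprK -hT /SS; ring.
rewrite !SSZ !SSD; apply: eq_bigr => c _; apply: eq_bigr => d _; congr (_ * _).
rewrite /frame_riemann mulrBr -!addrA mulNr; congr (_ + (_ + _)).
rewrite mulNr mulN1r big_distrr/= -!sumrN -!big_split/=; apply: eq_bigr => l _.
by ring.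
Qed.

Lemma ricciE : \matrix_(s, n) ricci e x s n =
  E^T *m (\matrix_(b, d) frame_ricci k frame_dcontortion b d) *m E.
Proof.
apply/matrixP => s n; rewrite mxE.
transitivity (\sum_(b < 4) \sum_(d < 4) E b s * E d n * frame_ricci k frame_dcontortion
  b d); last first.
  rewrite mxE; under [RHS]eq_bigr do rewrite mxE big_distrl/=.
  rewrite [RHS]exchange_big/=; apply: eq_bigr => b _; apply: eq_bigr => d _.
  by rewrite !mxE; ring.
have h rho : riemann e x rho s rho n = \sum_(a < 4) \sum_(c < 4) \sum_(b < 4)
    \sum_(d < 4) (F rho a * E c rho) * (E b s * E d n * frame_riemann k
      frame_dcontortion a b c d).
  rewrite (riemannE H Ux) -mulmxA mxE; apply: eq_bigr => a _; rewrite mxE.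
  under eq_bigr do rewrite RRE.
  under eq_bigr do rewrite big_distrl/=.
  rewrite exchange_big/= big_distrr/=; apply: eq_bigr => c _.
  rewrite big_distrr/=; apply: eq_bigr => b _; rewrite big_distrl big_distrr/=.
  by apply: eq_bigr => d _; rewrite -/F -/E; ring.
rewrite /ricci; under eq_bigr do rewrite h.
rewrite exchange_big/=.
transitivity (\sum_(a < 4) \sum_(b < 4) \sum_(d < 4) E b s * E d n * frame_riemann k
  frame_dcontortion a b a d).
  apply: eq_bigr => a _; rewrite exchange_big/=.
  rewrite -[RHS](sum_delta (fun c => \sum_(b < 4) \sum_(d < 4)
    E b s * E d n * frame_riemann k frame_dcontortion a b c d) a).
  apply: eq_bigr => c _.
  have -> : (a == c)%:R = \sum_(rho < 4) F rho a * E c rho.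
    by rewrite (FTE_delta uE) /delta4 eq_sym.
  rewrite big_distrl/=; apply: eq_bigr => r _; rewrite big_distrr/=.
  by apply: eq_bigr => b _; rewrite big_distrr.
rewrite exchange_big/=; apply: eq_bigr => b _.
rewrite exchange_big/=; apply: eq_bigr => d _.
by rewrite /frame_ricci big_distrr.
Qed.

(** Given symmetric Christoffel symbols, only the derivative of the trace [Gamma^r_{sr}] is not
    visibly symmetric. This trace belongs to [L + XX]: the covariant derivative of the contortion is
    traceless by antisymmetry, and flatness makes the antisymmetrized derivative of [L] a
    commutator, which has trace zero. *)
Lemma ricci_sym s n : ricci e x s n = ricci e x n s.
Proof.
have trDKK a b : \tr (F *m DKK a b *m E) = 0.
  rewrite mxtrace_mulC mulmxA EF// mul1mx /mxtrace big1// => i _.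
  rewrite DKKE big1 ?mulr0// => c _.
  by rewrite (frame_contortion_diag) (self_opp0 (cov3N H Ux a i i c)) !mulr0 addr0.
have hp a b dL : is_derive_mx x (dir a) (flat_conn e w b) dL ->
    \sum_(r < 4) partial a (fun y => christoffel e y r b r) x = \tr dL.
  move=> hL; have hX := is_derive_mxD hL (is_derive_XX H Ux a b).
  transitivity (\tr (dL + (- (L a *m XX e w b x) + XX e w b x *m L a + F *m DKK a b *m
    E))).
    apply: eq_bigr => r _; rewrite -(@derive_val _ _ _ _ _ _ _ (hX r r)) /partial.
    apply: near_eq_derive; near=> y; have Uy : U y by near: y; exact: (near_U H Ux).
    by rewrite (christoffelE H Uy).
  move: (trDKK a b) (L a) (XX e w b x); move: (F *m DKK a b *m E) => Z Z0 La Xb.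
  by rewrite !raddfD/= Z0 addr0 raddfN/= [X in - X]mxtrace_mulC addNr addr0.
have [d1 [d2 [h1 h2 flat]]] := flat_conn_curvature0 H Ux n s.
have htr : \sum_(r < 4) partial n (fun y => christoffel e y r s r) x =
    \sum_(r < 4) partial s (fun y => christoffel e y r n r) x.
  apply: etrans (hp _ _ _ h1) _; apply: etrans _ (esym (hp _ _ _ h2)).
  apply: subr0_eq; rewrite -raddfB/= flat.
  by rewrite raddfB/= mxtrace_mulC subrr.
have split_ricci m j : ricci e x m j =
    \sum_(r < 4) partial r (fun y => christoffel e y r m j) x
    - \sum_(r < 4) partial j (fun y => christoffel e y r m r) x
    + \sum_(r < 4) \sum_(l < 4) christoffel e x r l r * christoffel e x l m j
    - \sum_(r < 4) \sum_(l < 4) christoffel e x r l j * christoffel e x l m r.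
  by rewrite -sumrB -big_split/= -sumrB.
have cong4 (p1 p2 p3 p4 q1 q2 q3 q4 : R) : p1 = q1 -> p2 = q2 -> p3 = q3 ->
    p4 = q4 -> p1 - p2 + p3 - p4 = q1 - q2 + q3 - q4 by move=> -> -> -> ->.
apply: etrans (split_ricci s n) _; apply: etrans _ (esym (split_ricci n s)).
apply: cong4.
- apply: eq_bigr => r _; apply: (congr1 (fun f => partial r f x)).
  by apply/funext => y; exact: christoffel_sym.
- exact: htr.
- apply: eq_bigr => r _; apply: eq_bigr => l _.
  by rewrite [christoffel e x l s n]christoffel_sym.
rewrite exchange_big/=; apply: eq_bigr => r _; apply: eq_bigr => l _.
by rewrite mulrC [in LHS]christoffel_sym [christoffel e x l r n]christoffel_sym.
Unshelve. all: by end_near. Qed.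

Let fR : 'M[R]_4 := \matrix_(b, d) frame_ricci k frame_dcontortion b d.

Lemma frame_ricci_sym a f : frame_ricci k frame_dcontortion a f = frame_ricci k
  frame_dcontortion f a.
Proof.
have sR : fR^T = fR.
  have h : fR = F^T *m (\matrix_(s, n) ricci e x s n) *m F.
    by rewrite ricciE !mulmxA EFTr// mul1mx -mulmxA EF// mulmx1.
  rewrite h !trmx_mul trmxK mulmxA; congr (_ *m _ *m _).
  by apply/matrixP => i j; rewrite !mxE ricci_sym.
by have /matrixP/(_ f a) := sR; rewrite !mxE.
Qed.

Lemma scalar_curvatureE : scalar_curvature e x = frame_scalar k frame_dcontortion.
Proof.
have hE : E *m metric_inv E *m E^T = eta R.
  by rewrite -mulmxA (metric_inv_ET uE) mulmxA EF// mul1mx.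
transitivity (\tr (metric_inv E *m (\matrix_(s, n) ricci e x s n)^T)).
  rewrite /scalar_curvature; apply: eq_bigr => m _; rewrite mxE.
  by apply: eq_bigr => n _; rewrite !mxE.
rewrite ricciE -/fR !trmx_mul trmxK mxtrace_mulC -!mulmxA mxtrace_mulC -!mulmxA.
rewrite (mulmxA E) hE /mxtrace; apply: eq_bigr => b _.
rewrite mxE; under eq_bigr do rewrite mulrC -[eta R]eta_tr mxE.
by rewrite sum_eta !mxE.
Qed.

Lemma einsteinE a mu : \sum_(rho < 4) F rho a * einstein_mixed e x rho mu =
  \sum_(f < 4) F mu f * (sg4 f * (frame_ricci k frame_dcontortion f a
     - 2^-1 * (sg4 a * delta4 a f) * frame_scalar k frame_dcontortion)).
Proof.
set G : 'M[R]_4 := fR - (2^-1 * frame_scalar k frame_dcontortion) *: eta R.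
have hG : \matrix_(m, n) einstein e x m n = E^T *m G *m E.
  rewrite mulmxBr mulmxBl -ricciE -scalemxAr -scalemxAl -metricE.
  apply/matrixP => m n; rewrite [LHS]mxE /einstein scalar_curvatureE.
  by rewrite mxE_add mxE_opp [X in _ = X - _]mxE [X in _ = _ - X]mxE; ring.
have hF : F^T *m ((\matrix_(m, n) einstein e x m n) *m metric_inv E) = G *m eta R *m
  F^T.
  rewrite hG (metric_invE uE) !mulmxA EFTr// mul1mx -[_ *m E *m invmx E](mulmxA _ E)
    EF//.
  by rewrite mulmx1.
transitivity ((G *m eta R *m F^T) a mu).
  rewrite -hF mxE; apply: eq_bigr => r _; rewrite !mxE; congr (_ * _).
  by apply: eq_bigr => s _; rewrite mxE.
rewrite mxE; apply: eq_bigr => f _; rewrite mxE.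
under eq_bigr do rewrite mulrC -[eta R]eta_tr mxE.
rewrite sum_eta mxE_tr /G mxE_add mxE_opp mxE_scale [fR _ _]mxE etaE.
(* Puts the Ricci indices in the order in which [frame_identity] produces them. *)
by rewrite frame_ricci_sym; ring.
Qed.
End FrameRicci.

(** * Divergence of the momentum *)

Section SuperpotentialDerivative.
Context {R : realType}.
Variables (e : 'rV[R]_4 -> 'M[R]_4) (w : 'rV[R]_4 -> 'I_4 -> 'M[R]_4).
Variables (U : set 'rV[R]_4) (H : local_fields e w U).
Local Notation dir mu := (delta_mx ord0 mu : 'rV[R]_4).
Variables (x : 'rV[R]_4) (Ux : U x).
Let E := e x.
Let F := invmx E.
Let uE : E \in unitmx := coframe_unit H Ux.
Local Notation L nu := (flat_conn e w nu x).
Local Notation om nu := (w x nu).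
Local Notation k := (frame_contortion e w x).
Local Notation dk := (dk e w x).
Local Notation cov3 := (cov3 e w x).
Local Notation frame_dcontortion := (frame_dcontortion e w x).

Lemma superpot_upE (X : 'I_4 -> 'I_4 -> 'I_4 -> R) a b c : superpot_up X a b c =
  - (sg4 b * sg4 c * X b c a) + sg4 b * delta4 c a * torsion_vector X b
  - sg4 c * delta4 b a * torsion_vector X c.
Proof.
rewrite /superpot_up /superpot; move: (torsion_vector X) => C.
transitivity (- (sg4 b * sg4 c * X b c a) + sg4 b * delta4 c a * C b * (sg4 c * sg4 c)
  - sg4 c * delta4 b a * C c * (sg4 b * sg4 b)); first by ring.
by rewrite !sg4K !mulr1.
Qed.

Lemma superpot_up_sum n (g : 'I_n -> R) (X : 'I_n -> 'I_4 -> 'I_4 -> 'I_4 -> R) a b c :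
  superpot_up (fun a b c => \sum_(i < n) g i * X i a b c) a b c =
  \sum_(i < n) g i * superpot_up (X i) a b c.
Proof.
have hc j : torsion_vector (fun a b c => \sum_(i < n) g i * X i a b c) j = \sum_(i < n)
  g i * torsion_vector (X i) j.
  rewrite /torsion_vector; under eq_bigr do rewrite big_distrr/=.
  rewrite exchange_big/=; apply: eq_bigr => i _; rewrite big_distrr/=.
  by apply: eq_bigr => r _; ring.
rewrite superpot_upE !hc !big_distrr/= -sumrN -big_split/= -sumrB; apply: eq_bigr => i
  _.
by rewrite superpot_upE; move: (torsion_vector (X i)) => C; ring.
Qed.

Lemma superpot_upN (X : 'I_4 -> 'I_4 -> 'I_4 -> R) a b c :
  (forall a b c, X a b c = - X b a c) -> superpot_up X a b c = - superpot_up X a c b.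
Proof. by move=> XN; rewrite !superpot_upE (XN c b a); ring. Qed.

(** Contraction with [eta] commutes with the covariant derivative: by [z], the spin connection terms
    on the contracted pair cancel. *)
Lemma torsion_vector_cov3 nu b : torsion_vector (cov3 nu) b = torsion_vector (dk nu) b
  - \sum_(l < 4) om nu l b * torsion_vector k l.
Proof.
have z : \sum_(r < 4) \sum_(l < 4) sg4 r * (om nu l r * (k b l r + k b r l)) = 0.
  apply: self_opp0; rewrite -sumrN [LHS]exchange_big/=; apply: eq_bigr => r _.
  rewrite -sumrN; apply: eq_bigr => l _.
  by rewrite mulrA [sg4 l * _]mulrC (om_sgr H Ux); ring.
have -> : \sum_(l < 4) om nu l b * torsion_vector k l =
    \sum_(r < 4) \sum_(l < 4) om nu l b * (sg4 r * k l r r).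
  by rewrite exchange_big/=; apply: eq_bigr => l _; rewrite /torsion_vector big_distrr.
rewrite /torsion_vector -sumrB -[RHS]subr0 -[X in _ = _ - X]z -sumrB; apply: eq_bigr =>
  r _.
rewrite /cov3 mulrBr -addrA -opprD; congr (_ - _).
by rewrite big_distrr/= -big_split/=; apply: eq_bigr => l _; ring.
Qed.

Lemma sum_delta4r (f : 'I_4 -> R) a : \sum_(l < 4) f l * delta4 l a = f a.
Proof.
rewrite -[RHS](sum_delta f a); apply: eq_bigr => l _.
by rewrite /delta4 mulrC eq_sym.
Qed.

(** [superpot_up] is Lorentz equivariant, so applied to [cov3] it gives the covariant derivative of
    the superpotential, with [+ w] on the upper indices and [- w] on the lower one. The terms in
    which [w] meets the Kronecker delta cancel among [h1], [h2] and [h3]. *)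
Lemma superpot_up_cov3 nu a b c : superpot_up (cov3 nu) a b c = superpot_up (dk nu) a b
  c
  + \sum_(l < 4) om nu b l * superpot_up k a l c + \sum_(l < 4) om nu c l * superpot_up
    k a b l
  - \sum_(l < 4) om nu l a * superpot_up k l b c.
Proof.
have sd (f : 'I_4 -> R) j : \sum_(l < 4) f l * delta4 j l = f j.
  by rewrite -[RHS](sum_delta4r f j); apply: eq_bigr => l _; rewrite /delta4 eq_sym.
have h1 : \sum_(l < 4) om nu b l * superpot_up k a l c =
    sg4 b * sg4 c * (\sum_(l < 4) om nu l b * k l c a)
    - sg4 b * delta4 c a * (\sum_(l < 4) om nu l b * torsion_vector k l) - sg4 c *
      torsion_vector k c * om nu b a.
  under eq_bigr do rewrite superpot_upE; rewrite -(sum_delta4r (fun l => om nu b l) a).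
  move: (torsion_vector k) => C; rewrite !big_distrr/= -!sumrB; apply: eq_bigr => l _.
  transitivity (- ((om nu b l * sg4 l) * sg4 c * k l c a) +
    (om nu b l * sg4 l) * delta4 c a * C l - sg4 c * C c * (om nu b l * delta4 l a)).
    by ring.
  by rewrite (om_sgr H Ux); ring.
have h2 : \sum_(l < 4) om nu c l * superpot_up k a b l =
    sg4 b * sg4 c * (\sum_(l < 4) om nu l c * k b l a)
    + sg4 c * delta4 b a * (\sum_(l < 4) om nu l c * torsion_vector k l) + sg4 b *
      torsion_vector k b * om nu c a.
  under eq_bigr do rewrite superpot_upE; rewrite -(sum_delta4r (fun l => om nu c l) a).
  move: (torsion_vector k) => C; rewrite !big_distrr/= -!big_split/=; apply: eq_bigr =>
    l _.
  transitivity (- ((om nu c l * sg4 l) * sg4 b * k b l a) -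
    (om nu c l * sg4 l) * delta4 b a * C l + sg4 b * C b * (om nu c l * delta4 l a)).
    by ring.
  by rewrite (om_sgr H Ux); ring.
have h3 : \sum_(l < 4) om nu l a * superpot_up k l b c =
    - (sg4 b * sg4 c * (\sum_(l < 4) om nu l a * k b c l))
    + sg4 b * torsion_vector k b * om nu c a - sg4 c * torsion_vector k c * om nu b a.
  under eq_bigr do rewrite superpot_upE.
  rewrite -(sd (fun l => om nu l a) c) -(sd (fun l => om nu l a) b).
  move: (torsion_vector k) => C; rewrite !big_distrr/= -sumrN -big_split/= -sumrB.
  by apply: eq_bigr => l _; ring.
rewrite h1 h2 h3 !superpot_upE !torsion_vector_cov3 /cov3 !big_split/=.
by move: (torsion_vector k) (torsion_vector (dk nu)) => C D; ring.
Qed.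
End SuperpotentialDerivative.

Section DivMomentum.
Context {R : realType}.
Variables (e : 'rV[R]_4 -> 'M[R]_4) (w : 'rV[R]_4 -> 'I_4 -> 'M[R]_4).
Variables (U : set 'rV[R]_4) (H : local_fields e w U).
Local Notation dir mu := (delta_mx ord0 mu : 'rV[R]_4).
Variables (x : 'rV[R]_4) (Ux : U x).
Let E := e x.
Let F := invmx E.
Let uE : E \in unitmx := coframe_unit H Ux.
Local Notation L nu := (flat_conn e w nu x).
Local Notation om nu := (w x nu).
Local Notation k := (frame_contortion e w x).
Local Notation dk := (dk e w x).
Local Notation cov3 := (cov3 e w x).
Local Notation frame_dcontortion := (frame_dcontortion e w x).

Definition supmx y a : 'M[R]_4 := \matrix_(b, c) superpot_up (frame_contortion e w y) a
  b c.
(** [S_a^{mu nu}] as a matrix in its coordinate indices, so that the derivative of the momentum is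
    one of a matrix product. *)
Definition Mmx y a : 'M[R]_4 := invmx (e y) *m supmx y a *m (invmx (e y))^T.
Definition covsup nu a : 'M[R]_4 := \matrix_(b, c) superpot_up (cov3 nu) a b c.

Lemma momentum_mx kappa y a mu nu : U y -> momentum kappa e w y a mu nu =
  - (2 / kappa ^+ 2) * (vol (e y) * Mmx y a mu nu).
Proof.
move=> Uy; rewrite (momentumE w (coframe_unit H Uy)) /Mmx -mulmxA mxE.
rewrite [RHS]mulrA -mulrAC mulNr mulrAC -mulNr [2 * _]mulrC; congr (_ * _); first by
  ring.
apply: eq_bigr => b _; rewrite mxE big_distrr/=; apply: eq_bigr => c _.
by rewrite !mxE; ring.
Qed.

Lemma is_derive_supmx nu a :
  is_derive_mx x (dir nu) (fun y => supmx y a) (\matrix_(b, c) superpot_up (dk nu) a b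
    c).
Proof.
have sc f (r df : R) : is_derive x (dir nu) f df ->
    is_derive x (dir nu) (fun y => r * f y) (r * df).
  move=> hf; apply: is_derive_eq (is_derive_scalar_mul
    (is_derive_cst (r : R) x (dir nu)) hf) _.
  by rewrite mul0r add0r.
have hc b : is_derive x (dir nu) (fun y => torsion_vector (frame_contortion e w y) b)
  (torsion_vector (dk nu) b).
  by apply: is_derive_scalar_sum => r; apply: sc; exact: (is_derive_k H Ux).
move=> b c; rewrite mxE superpot_upE (_ : (fun y => _) = fun y =>
  (- (sg4 b * sg4 c)) * frame_contortion e w y b c a + sg4 b * delta4 c a *
    torsion_vector (frame_contortion e w y) b
  + (- (sg4 c * delta4 b a)) * torsion_vector (frame_contortion e w y) c); last first.
  by apply/funext => y; rewrite mxE superpot_upE !mulNr.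
apply: is_derive_eq (is_derive_scalar_add (is_derive_scalar_add
  (sc _ _ _ (is_derive_k H Ux nu b c a)) (sc _ _ _ (hc b))) (sc _ _ _ (hc c))) _.
by rewrite !mulNr.
Qed.

Lemma tr_om nu : \tr (om nu) = 0.
Proof.
apply: big1 => i _; have h := self_opp0 (om_sg H Ux nu i i).
by rewrite -[LHS]mul1r -(sg4K i) -mulrA h mulr0.
Qed.

Lemma FdEF nu : F *m dE e nu x *m F = L nu *m F - F *m om nu.
Proof.
rewrite (F_dE H Ux) -/E -/F mulmxBl; congr (_ - _).
by rewrite -[LHS]mulmxA EF// mulmx1.
Qed.

(** The volume contributes [tr L], since [w] is traceless, and the two inverse coframes contribute
    [- L M - M L^T]. All terms in [w] combine with the partial derivative of the superpotential into
    [covsup]. *)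
Lemma covD_momentum kappa a mu nu :
  partial nu (fun y => momentum kappa e w y a mu nu) x
    - \sum_(b < 4) om nu b a * momentum kappa e w x b mu nu =
  - (2 / kappa ^+ 2) * (vol E * (\tr (L nu) * Mmx x a mu nu
    - (L nu *m Mmx x a) mu nu - (Mmx x a *m (L nu)^T) mu nu
    + (F *m covsup nu a *m F^T) mu nu)).
Proof.
have cE i j : {for x, continuous (fun y => e y i j)} by exact: (coframe_cont H).
have dv := is_derive_vol cE uE (is_derive_e H Ux nu).
have dM := is_derive_mxM (is_derive_mxM (is_derive_F H Ux nu) (is_derive_supmx nu a))
  (is_derive_mx_tr (is_derive_F H Ux nu)).
have d0 := is_derive_scalar_mul (is_derive_cst (- (2 / kappa ^+ 2) : R) x (dir nu))
  (is_derive_scalar_mul dv (dM mu nu)).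
have -> : partial nu (fun y => momentum kappa e w y a mu nu) x =
   'D_(dir nu) (fun y => - (2 / kappa ^+ 2) * (vol (e y) * Mmx y a mu nu)) x.
  apply: near_eq_derive; near=> y; have Uy : U y by near: y; exact: (near_U H Ux).
  exact: momentum_mx.
rewrite (@derive_val _ _ _ _ _ _ _ d0) mul0r add0r.
under eq_bigr do rewrite momentum_mx// -/E.
have -> : \sum_(b < 4) om nu b a * (- (2 / kappa ^+ 2) * (vol E * Mmx x b mu nu)) =
    - (2 / kappa ^+ 2) * (vol E *
       (F *m (\sum_(b < 4) om nu b a *: supmx x b) *m F^T) mu nu).
  rewrite mulmx_sumr mulmx_suml summxE !big_distrr/=; apply: eq_bigr => b _.
  by rewrite -scalemxAr -scalemxAl mxE_scale /Mmx -/E -/F; ring.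
rewrite -/E -/F FdEF.
have -> : \tr (F *m dE e nu x) = \tr (L nu).
  rewrite (F_dE H Ux) -/E -/F linearB/= [X in _ - X]mxtrace_mulC mulmxA EF// mul1mx
    tr_om.
  by rewrite subr0.
have -> : covsup nu a = \matrix_(b, c) superpot_up (dk nu) a b c + om nu *m supmx x a
    + supmx x a *m (om nu)^T - \sum_(b < 4) om nu b a *: supmx x b.
  apply/matrixP => b c; rewrite mxE (superpot_up_cov3 H Ux) !mxE_add mxE_opp summxE.
  rewrite [X in _ = X + _ + _ - _]mxE ![(_ *m _) _ _]mxE; congr (_ + _ + _ - _).
  - by apply: eq_bigr => l _; rewrite mxE.
  - by apply: eq_bigr => l _; rewrite !mxE mulrC.
  - by apply: eq_bigr => l _; rewrite !mxE.
rewrite -[cst _ _]/(- (2 / kappa ^+ 2)) /Mmx -/E -/F.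
move: (L nu) (om nu) (supmx x a) => La o S.
move: (\matrix_(b, c) _) (\sum_b _) => S' Z.
have -> : (- (La *m F - F *m o) *m S + F *m S') *m F^T +
    F *m S *m (- (La *m F - F *m o))^T =
    - (La *m (F *m S *m F^T)) - F *m S *m F^T *m La^T
    + F *m (S' + o *m S + S *m o^T - Z) *m F^T + F *m Z *m F^T.
  have -> (A B : 'M[R]_4) : (- (A - B))^T = B^T - A^T.
    by apply/matrixP => i j; rewrite !mxE; ring.
  rewrite !trmx_mul.
  rewrite !(mulmxDl, mulmxDr, mulNmx, mulmxN) !mulmxA.
  by apply/matrixP => i j; rewrite !(mxE_add, mxE_opp); ring.
by rewrite !(mxE_add _ _ mu) !mxE_opp; ring.
Unshelve. all: by end_near. Qed.

Lemma torsion_trace_flat_conn l : torsion_trace e w x l =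
  \sum_(r < 4) L r r l - \tr (L l).
Proof. by rewrite -sumrB; apply: eq_bigr => r _; rewrite torsion_coord_flat_conn. Qed.

Lemma EF_delta b c : \sum_(l < 4) E b l * F l c = (b == c)%:R.
Proof. by have /matrixP/(_ b c) := EF uE; rewrite !mxE. Qed.

Lemma MmxE a mu l : Mmx x a mu l =
  \sum_(f < 4) \sum_(c < 4) F mu f * F l c * superpot_up k a f c.
Proof.
rewrite /Mmx -mulmxA mxE; apply: eq_bigr => f _; rewrite mxE big_distrr/=.
by apply: eq_bigr => c _; rewrite !mxE -/F; ring.
Qed.

Lemma MmxN a i j : Mmx x a i j = - Mmx x a j i.
Proof.
rewrite !MmxE exchange_big/= -sumrN; apply: eq_bigr => c _; rewrite -sumrN.
by apply: eq_bigr => f _; rewrite (superpot_upN (X := k))//; [ring|exact: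
  frame_contortionN].
Qed.

(** Summed over [nu], the trace of [L] and the term in [L^T] form the torsion trace. *)
Lemma div_trace_part a mu :
  \sum_(nu < 4) (\tr (L nu) * Mmx x a mu nu - (Mmx x a *m (L nu)^T) mu nu) =
  - \sum_(f < 4) F mu f * \sum_(c < 4) torsion_vector k c * superpot_up k a f c.
Proof.
transitivity (- \sum_(l < 4) Mmx x a mu l * torsion_trace e w x l).
  under [in RHS]eq_bigr do rewrite torsion_trace_flat_conn mulrBr big_distrr/=.
  rewrite !sumrB opprB; congr (_ - _); first by apply: eq_bigr => l _; rewrite mulrC.
  rewrite exchange_big/=; apply: eq_bigr => l _; rewrite mxE.
  by apply: eq_bigr => r _; rewrite !mxE.
congr (- _); under eq_bigr do rewrite MmxE (torsion_traceE w uE) big_distrl/=.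
rewrite exchange_big/=; apply: eq_bigr => f _.
under eq_bigr do rewrite big_distrl/=.
rewrite exchange_big/= big_distrr/=; apply: eq_bigr => c _.
transitivity (F mu f * superpot_up k a f c * \sum_(l < 4) \sum_(b < 4)
  torsion_vector k b * (E b l * F l c)).
  rewrite big_distrr/=; apply: eq_bigr => l _; rewrite !big_distrr/=.
  by apply: eq_bigr => b _; move: (torsion_vector k) => C; ring.
rewrite exchange_big/=.
under eq_bigr do rewrite -big_distrr/= EF_delta eq_sym mulrC.
by rewrite sum_delta; move: (torsion_vector k) => C; ring.
Qed.

(** [Mmx] is antisymmetric, so it sees only the antisymmetric part of [L], which is half the
    torsion. *)
Lemma div_torsion_part a mu : \sum_(nu < 4) (L nu *m Mmx x a) mu nu =
  \sum_(f < 4) F mu f * (2^-1 * frame_torsion_term k a f).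
Proof.
have h1 : \sum_(nu < 4) (L nu *m Mmx x a) mu nu =
    2^-1 * \sum_(l < 4) \sum_(nu < 4) torsion_coord e w x mu l nu * Mmx x a l nu.
  have h : \sum_(nu < 4) (L nu *m Mmx x a) mu nu =
      \sum_(l < 4) \sum_(nu < 4) L nu mu l * Mmx x a l nu.
    by rewrite exchange_big/=; apply: eq_bigr => n _; rewrite mxE.
  have h' : \sum_(nu < 4) (L nu *m Mmx x a) mu nu =
      - \sum_(l < 4) \sum_(nu < 4) L l mu nu * Mmx x a l nu.
    rewrite h exchange_big/= -sumrN; apply: eq_bigr => n _; rewrite -sumrN.
    by apply: eq_bigr => l _; rewrite [in RHS]MmxN mulrN opprK.
  transitivity (2^-1 * (\sum_(nu < 4) (L nu *m Mmx x a) mu nu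
     + \sum_(nu < 4) (L nu *m Mmx x a) mu nu)); first by field.
  rewrite {1}h h' -sumrB; congr (_ * _); apply: eq_bigr => l _; rewrite -sumrB.
  by apply: eq_bigr => n _; rewrite torsion_coord_flat_conn mulrBl.
rewrite h1; under [RHS]eq_bigr do rewrite mulrCA.
rewrite -big_distrr/=; congr (_ * _).
pose Tm : 'M[R]_4 := \matrix_(b, c) \sum_(f < 4) F mu f * (sg4 f * torsion_of k f b c).
have hT l n : torsion_coord e w x mu l n = (E^T *m Tm *m E) l n.
  rewrite (torsion_coordE w uE) slot_sum mxE.
  under [RHS]eq_bigr do rewrite mxE big_distrl/=.
  rewrite exchange_big/= [RHS]exchange_big/=; apply: eq_bigr => b _.
  rewrite exchange_big/=; apply: eq_bigr => c _.
  rewrite !mxE big_distrr big_distrl/=; apply: eq_bigr => f _.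
  by rewrite FetaE -torsion_of_frame_contortion; ring.
transitivity (\tr ((E^T *m Tm *m E)^T *m Mmx x a)).
  rewrite exchange_big/=; apply: eq_bigr => n _; rewrite [RHS]mxE; apply: eq_bigr => l
    _.
  by rewrite hT mxE_tr.
rewrite /Mmx -/E -/F !trmx_mul trmxK !mulmxA mxtrace_mulC !mulmxA EFTr// mul1mx.
rewrite -[_ *m E *m F]mulmxA EF// mulmx1 /mxtrace.
transitivity (\sum_(c < 4) \sum_(b < 4) Tm b c * superpot_up k a b c).
  apply: eq_bigr => c _; rewrite [LHS]mxE; apply: eq_bigr => b _.
  by rewrite mxE_tr [supmx _ _ _ _]mxE.
rewrite exchange_big/= /frame_torsion_term.
under [RHS]eq_bigr do rewrite big_distrr/=.
rewrite [RHS]exchange_big/=; apply: eq_bigr => b _.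
under [RHS]eq_bigr do rewrite big_distrr/=.
rewrite [RHS]exchange_big/=; apply: eq_bigr => c _.
rewrite mxE big_distrl/=; apply: eq_bigr => f _; ring.
Qed.

Lemma div_cov_part a mu : \sum_(nu < 4) (F *m covsup nu a *m F^T) mu nu =
  \sum_(f < 4) F mu f * \sum_(c < 4) sg4 f * sg4 c * superpot (frame_dcontortion c) a f
    c.
Proof.
under eq_bigr do rewrite -mulmxA mxE.
rewrite exchange_big/=; apply: eq_bigr => f _; rewrite -big_distrr/=; congr (_ * _).
under eq_bigr do rewrite mxE.
rewrite exchange_big/=; apply: eq_bigr => c _.
transitivity (superpot_up (frame_dcontortion c) a f c); last by [].
rewrite /frame_dcontortion superpot_up_sum; apply: eq_bigr => n _.
by rewrite [in LHS]mxE [in LHS]mxE mulrC.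
Qed.

Lemma div_momentumE kappa a mu : div_momentum kappa e w x a mu =
  - (2 / kappa ^+ 2) * vol E *
  \sum_(f < 4) F mu f * (frame_div k frame_dcontortion a f - 2^-1 * frame_torsion_term
    k a f).
Proof.
rewrite /div_momentum; under eq_bigr do rewrite covD_momentum.
rewrite -!big_distrr/= mulrA; congr (_ * _).
transitivity (\sum_(nu < 4) (\tr (L nu) * Mmx x a mu nu - (Mmx x a *m (L nu)^T) mu nu)
  - \sum_(nu < 4) (L nu *m Mmx x a) mu nu
  + \sum_(nu < 4) (F *m covsup nu a *m F^T) mu nu).
  by rewrite -sumrB -big_split/=; apply: eq_bigr => n _; ring.
rewrite div_trace_part div_torsion_part div_cov_part.
rewrite -opprD addrC -!big_split/= -sumrB; apply: eq_bigr => f _.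
by rewrite -!mulrDr -mulrBr /frame_div sumrB; congr (_ * _); ring.
Qed.
End DivMomentum.

(** * Derivative of the Hamiltonian *)

Section FrameHamiltonian.
Context {R : realType}.
Implicit Types (t u p P : 'I_4 -> 'I_4 -> 'I_4 -> R).

Definition ip3 t u : R :=
  \sum_(i < 4) \sum_(j < 4) \sum_(l < 4) t i j l * u i j l.

(** With its analogues for the other slots, this moves the coframe matrices of one factor onto the
    other, where they meet their inverses. *)
Lemma ip_slot1 A t u : ip3 (slot1 A t) u = ip3 t (slot1 A^T u).
Proof.
rewrite /ip3 exchange_big/= [RHS]exchange_big/=; apply: eq_bigr => j _.
rewrite exchange_big/= [RHS]exchange_big/=; apply: eq_bigr => l _.
under eq_bigr do rewrite big_distrl/=.
rewrite exchange_big/=; apply: eq_bigr => m _; rewrite big_distrr/=.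
by apply: eq_bigr => i _; rewrite mxE; ring.
Qed.

Lemma ip_slot2 A t u : ip3 (slot2 A t) u = ip3 t (slot2 A^T u).
Proof.
apply: eq_bigr => i _.
rewrite exchange_big/= [RHS]exchange_big/=; apply: eq_bigr => l _.
under eq_bigr do rewrite big_distrl/=.
rewrite exchange_big/=; apply: eq_bigr => m _; rewrite big_distrr/=.
by apply: eq_bigr => j _; rewrite mxE; ring.
Qed.

Lemma ip_slot3 A t u : ip3 (slot3 A t) u = ip3 t (slot3 A^T u).
Proof.
apply: eq_bigr => i _; apply: eq_bigr => j _.
under eq_bigr do rewrite big_distrl/=.
rewrite exchange_big/=; apply: eq_bigr => m _; rewrite big_distrr/=.
by apply: eq_bigr => l _; rewrite mxE; ring.
Qed.

(** The cyclic shift of indices in [P^{rho mu nu} P_{mu nu rho}]. *)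
Definition rot3 t : 'I_4 -> 'I_4 -> 'I_4 -> R := fun i j l => t j l i.

Lemma rot_slot A B C t : rot3 (slot1 A (slot2 B (slot3 C t))) =
  slot2 A (slot3 B (slot1 C (rot3 t))).
Proof. by []. Qed.

Definition fmom (E : 'M[R]_4) P d b c : R :=
  \sum_(m < 4) \sum_(n < 4) E b m * E c n * P d m n.
Definition ptr p b : R := \sum_(a < 4) p a b a.
(** [qmom] and [fqmom] at [superpot_up k] are convertible to [frame_quad] and [frame_quad_grad]; a
    general argument is needed for differentiation. *)
Definition qmom p : R :=
  2 * (\sum_(b < 4) \sum_(c < 4) \sum_(d < 4) sg4 c * p d b c * p b c d)
  + \sum_(b < 4) sg4 b * (ptr p b * ptr p b).
Definition fqmom p a f : R :=
  2 * (\sum_(c < 4) \sum_(d < 4) sg4 c * (p a c d * p d f c))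
  + 2 * (\sum_(b < 4) \sum_(d < 4) sg4 a * (p b a d * p d b f))
  + sg4 a * ptr p a * ptr p f + \sum_(b < 4) sg4 b * ptr p b * p a b f.

Section Frame.
Variables (E : 'M[R]_4) (uE : E \in unitmx) (P : 'I_4 -> 'I_4 -> 'I_4 -> R).
Let F := invmx E.
Let p := fmom E P.

Lemma fmom_slot : p = slot2 E (slot3 E P).
Proof.
apply: ext3 => d b c; rewrite /slot2 /slot3; apply: eq_bigr => m _.
by rewrite big_distrr/=; apply: eq_bigr => n _; rewrite mulrA.
Qed.

Lemma mom_slot : P = slot2 F (slot3 F p).
Proof. by rewrite fmom_slot -!slot23C slot2M slot3M FE// slot2_1 slot3_1. Qed.

Lemma momE mu n d : P d mu n = \sum_(f < 4) \sum_(g < 4) F mu f * F n g * p d f g.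
Proof.
rewrite {1}mom_slot /slot2 /slot3; apply: eq_bigr => f _.
by rewrite big_distrr/=; apply: eq_bigr => g _; rewrite mulrA.
Qed.

Lemma mom_coordE : mom_coord E P = slot1 (F *m eta R) P.
Proof.
apply: ext3 => r m n; rewrite /mom_coord invmx_eta; apply: eq_bigr => a _.
rewrite mxE big_distrl/=; apply: eq_bigr => b _.
by rewrite -[in LHS]eta_tr mxE -/F; ring.
Qed.

Lemma lower3E t : lower3 E t = slot1 (metric E) (slot2 (metric E) (slot3 (metric E) t)).
Proof. by apply: ext3 => i j l; rewrite slot_sum. Qed.

Lemma quadratic1 :
  \sum_(rho < 4) \sum_(mu < 4) \sum_(nu < 4)
    mom_coord E P rho mu nu * lower3 E (mom_coord E P) mu nu rho =
  \sum_(b < 4) \sum_(c < 4) \sum_(d < 4) sg4 c * p d b c * p b c d.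
Proof.
transitivity (ip3 (mom_coord E P) (rot3 (lower3 E (mom_coord E P)))); first by [].
have hm : mom_coord E P = slot1 (F *m eta R) (slot2 F (slot3 F p)).
  by rewrite mom_coordE {1}mom_slot.
have hl : lower3 E (mom_coord E P) =
    slot1 E^T (slot2 (E^T *m eta R) (slot3 (E^T *m eta R) p)).
  rewrite lower3E hm -!slot13C -!slot12C slot1M -!slot23C slot2M slot3M.
  by rewrite metric_F// mulmxA metric_F// -mulmxA etaK mulmx1.
rewrite hl rot_slot hm ip_slot1 ip_slot2 ip_slot3.
rewrite !(=^~ slot12C, =^~ slot13C, =^~ slot23C) slot1M slot2M slot3M.
rewrite trmx_mul eta_tr (mulmxA F^T) EFTr// mul1mx -(mulmxA (eta R)) (mulmxA F^T).
rewrite EFTr// mul1mx etaK slot1_1 slot2_1.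
rewrite /ip3.
transitivity (\sum_(d < 4) \sum_(b < 4) \sum_(c < 4) sg4 c * p d b c * p b c d).
  apply: eq_bigr => d _; apply: eq_bigr => b _; apply: eq_bigr => c _.
  by rewrite slot3_eta /rot3; ring.
rewrite exchange_big/=; apply: eq_bigr => b _.
by rewrite exchange_big.
Qed.

Lemma quadratic2 :
  \sum_(mu < 4) mom_trace E P mu * (\sum_(nu < 4) metric E mu nu * mom_trace E P nu) =
  \sum_(b < 4) sg4 b * (ptr p b * ptr p b).
Proof.
pose v : 'cV[R]_4 := \col_b ptr p b.
have hv mu : mom_trace E P mu = (F *m v) mu ord0.
  rewrite mxE; under eq_bigr do rewrite mxE /ptr big_distrr/=.
  rewrite exchange_big/=; apply: eq_bigr => a _.
  rewrite /=; under eq_bigr do rewrite momE big_distrr/=.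
  rewrite exchange_big/=; apply: eq_bigr => f _.
  under eq_bigr do rewrite big_distrr/=.
  rewrite exchange_big/= -(sum_delta (fun g => F mu f * p a f g) a).
  apply: eq_bigr => g _.
  have -> : (a == g)%:R = \sum_(n < 4) E a n * F n g.
    by have /matrixP/(_ a g) := EF uE; rewrite !mxE.
  by rewrite big_distrl/=; apply: eq_bigr => n _; ring.
transitivity (((F *m v)^T *m (metric E *m (F *m v))) ord0 ord0).
  rewrite mxE; apply: eq_bigr => m _; rewrite mxE_tr hv; congr (_ * _).
  by rewrite mxE; apply: eq_bigr => n _; rewrite hv.
rewrite trmx_mul (mulmxA (metric E)) metric_F// !mulmxA -(mulmxA v^T) EFTr// mulmx1.
rewrite -mulmxA mxE; apply: eq_bigr => b _.
by rewrite !mxE sum_eta !mxE; ring.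
Qed.

(** In the frame the metric disappears: the coframe enters only through the volume and the frame
    components of [P]. The 4 is the 2 of the Hamiltonian times the 2 in [qmom]. *)
Lemma hamiltonianE kappa :
  hamiltonian kappa E P = - (kappa ^+ 2 / 4) * ((vol E)^-1 * qmom p).
Proof.
have v0 : vol E != 0 by rewrite normr_eq0 -unitfE -unitmxE.
by rewrite /hamiltonian quadratic1 quadratic2 /qmom; field.
Qed.
End Frame.

Lemma is_derive_coord (E V : 'M[R]_4) : is_derive_mx E V (fun G => G) V.
Proof.
move=> i j; have h : derivable (fun G : 'M[R]_4 => G) E V by exact: derivable_id.
have /matrixP/(_ i j) := derive_mx h.
rewrite mxE derive_id => ->; apply: derivableP.
by move/derivable_mxP : h; apply.
Qed.

Section Derivative.
Variables (E : 'M[R]_4) (uE : E \in unitmx) (P : 'I_4 -> 'I_4 -> 'I_4 -> R).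
Variables (a mu : 'I_4).
Let F := invmx E.
Let p := fmom E P.
Let V : 'M[R]_4 := delta_mx a mu.
Hypothesis PN : forall d m n, P d m n = - P d n m.

Lemma fmomN d b c : p d b c = - p d c b.
Proof.
rewrite /p /fmom exchange_big/= -sumrN; apply: eq_bigr => n _; rewrite -sumrN.
by apply: eq_bigr => m _; rewrite PN; ring.
Qed.

Definition dfmom f d b c : R := delta4 b a * p d f c + delta4 c a * p d b f.

(** Varying one coframe entry leaves one index of [P] equal to [mu]; writing [P] through its frame
    components gives the factor [F mu f]. *)
Lemma is_derive_fmom d b c : is_derive E V (fun G => fmom G P d b c)
  (\sum_(f < 4) F mu f * dfmom f d b c).
Proof.
have hc := is_derive_coord E V.
have h := is_derive_scalar_sum (fun m => is_derive_scalar_sum (fun n =>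
  is_derive_scalar_mul (is_derive_scalar_mul (hc b m) (hc c n))
    (is_derive_cst (P d m n : R) E V))).
apply: is_derive_eq h _.
have Vb i m : V i m = delta4 i a * (mu == m)%:R.
  by rewrite mxE /delta4 eq_sym [m == mu]eq_sym; case: eqP; case: eqP;
    rewrite ?mulr0 ?mulr1.
transitivity (delta4 b a * \sum_(n < 4) E c n * P d mu n
   + delta4 c a * \sum_(m < 4) E b m * P d m mu).
  under eq_bigr do under eq_bigr do rewrite mulr0 addr0 mulrDl !Vb.
  under eq_bigr do rewrite big_split/=.
  rewrite big_split/=; congr (_ + _).
    rewrite exchange_big/= big_distrr/=; apply: eq_bigr => n _.
    rewrite -[RHS](sum_delta (fun m => delta4 b a * (E c n * P d m n)) mu).
    by apply: eq_bigr => m _; rewrite /cst; ring.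
  rewrite big_distrr/=; apply: eq_bigr => m _.
  rewrite -[RHS](sum_delta (fun n => delta4 c a * (E b m * P d m n)) mu).
  by apply: eq_bigr => n _; rewrite /cst; ring.
have FEs f c' : \sum_(n < 4) E c' n * F n f = (c' == f)%:R.
  by have /matrixP/(_ c' f) := EF uE; rewrite !mxE.
have -> : \sum_(n < 4) E c n * P d mu n = \sum_(f < 4) F mu f * p d f c.
  under eq_bigr do rewrite (momE uE) big_distrr/=.
  rewrite exchange_big/=; apply: eq_bigr => f _.
  under eq_bigr do rewrite big_distrr/=.
  rewrite exchange_big/= -(sum_delta (fun g => F mu f * p d f g) c).
  apply: eq_bigr => g _; rewrite -FEs big_distrl/=.
  by apply: eq_bigr => n _; rewrite -/F -/p; ring.
have -> : \sum_(m < 4) E b m * P d m mu = \sum_(f < 4) F mu f * p d b f.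
  under eq_bigr do rewrite (momE uE) exchange_big big_distrr/=.
  rewrite exchange_big/=; apply: eq_bigr => f _.
  under eq_bigr do rewrite big_distrr/=.
  rewrite exchange_big/= -(sum_delta (fun g => F mu f * p d g f) b).
  apply: eq_bigr => g _; rewrite -FEs big_distrl/=.
  by apply: eq_bigr => n _; rewrite -/F -/p; ring.
rewrite !big_distrr/= -big_split/=; apply: eq_bigr => f _.
by rewrite /dfmom; ring.
Qed.
End Derivative.
End FrameHamiltonian.

(** * The quadratic form of the Hamiltonian and its variation *)

Section HamiltonianDerivative.
Context {R : realType}.
Implicit Types (X Y : 'I_4 -> 'I_4 -> 'I_4 -> R).

Lemma sum_delta4l (f : 'I_4 -> R) a : \sum_(l < 4) delta4 l a * f l = f a.
Proof. by rewrite -[RHS](sum_delta4r f a); apply: eq_bigr => l _; rewrite mulrC. Qed.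

Lemma sum3_delta1 X a : \sum_(b < 4) \sum_(c < 4) \sum_(d < 4) delta4 b a * X b c d =
  \sum_(c < 4) \sum_(d < 4) X a c d.
Proof.
rewrite -[RHS](sum_delta4l (fun b => \sum_(c < 4) \sum_(d < 4) X b c d) a).
apply: eq_bigr => b _; rewrite big_distrr/=; apply: eq_bigr => c _.
by rewrite big_distrr.
Qed.

Lemma sum3_delta2 X a : \sum_(b < 4) \sum_(c < 4) \sum_(d < 4) delta4 c a * X b c d =
  \sum_(b < 4) \sum_(d < 4) X b a d.
Proof.
apply: eq_bigr => b _; rewrite -[RHS](sum_delta4l (fun c => \sum_(d < 4) X b c d) a).
by apply: eq_bigr => c _; rewrite big_distrr.
Qed.

Lemma sum3_delta3 X a : \sum_(b < 4) \sum_(c < 4) \sum_(d < 4) delta4 d a * X b c d =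
  \sum_(b < 4) \sum_(c < 4) X b c a.
Proof. by do 2 (apply: eq_bigr => ? _); rewrite sum_delta4l. Qed.

(** Derivative of the quadratic form [qmom] at [Y] along [X]. *)
Definition bmom X Y : R :=
  2 * (\sum_(b < 4) \sum_(c < 4) \sum_(d < 4)
         sg4 c * (X d b c * Y b c d + Y d b c * X b c d))
  + 2 * \sum_(b < 4) sg4 b * (ptr X b * ptr Y b).

Lemma bmom_sum (g : 'I_4 -> R) (X : 'I_4 -> 'I_4 -> 'I_4 -> 'I_4 -> R) Y :
  bmom (fun d b c => \sum_(f < 4) g f * X f d b c) Y = \sum_(f < 4) g f * bmom (X f) Y.
Proof.
have h1 : \sum_(b < 4) \sum_(c < 4) \sum_(d < 4)
    sg4 c * ((\sum_(f < 4) g f * X f d b c) * Y b c d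
           + Y d b c * \sum_(f < 4) g f * X f b c d) =
    \sum_(f < 4) g f * \sum_(b < 4) \sum_(c < 4) \sum_(d < 4)
         sg4 c * (X f d b c * Y b c d + Y d b c * X f b c d).
  under [RHS]eq_bigr do rewrite big_distrr/=.
  rewrite [RHS]exchange_big/=; apply: eq_bigr => b _.
  under [RHS]eq_bigr do rewrite big_distrr/=.
  rewrite [RHS]exchange_big/=; apply: eq_bigr => c _.
  under [RHS]eq_bigr do rewrite big_distrr/=.
  rewrite [RHS]exchange_big/=; apply: eq_bigr => d _.
  rewrite big_distrl big_distrr/= -big_split/= big_distrr/=.
  by apply: eq_bigr => f _; ring.
have h2 b : ptr (fun d b c => \sum_(f < 4) g f * X f d b c) b =
    \sum_(f < 4) g f * ptr (X f) b.
  rewrite /ptr exchange_big/=; apply: eq_bigr => f _.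
  by rewrite big_distrr.
have h3 : \sum_(b < 4) sg4 b * (ptr (fun d b c => \sum_(f < 4) g f * X f d b c) b * ptr
  Y b) =
    \sum_(f < 4) g f * \sum_(b < 4) sg4 b * (ptr (X f) b * ptr Y b).
  under [RHS]eq_bigr do rewrite big_distrr/=.
  rewrite [RHS]exchange_big/=; apply: eq_bigr => b _.
  rewrite h2 big_distrl big_distrr/=; apply: eq_bigr => f _.
  by move: (ptr (X f)) (ptr Y) => s t; ring.
rewrite /bmom h1 h3 mulr_sumr [X in _ + X]mulr_sumr -big_split/=.
by apply: eq_bigr => f _; rewrite mulrDr !(mulrCA 2).
Qed.

Lemma is_derive_qmom (V : normedModType R) (q : V -> 'I_4 -> 'I_4 -> 'I_4 -> R) dq x v :
  (forall d b c, is_derive x v (fun y => q y d b c) (dq d b c)) ->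
  is_derive x v (fun y => qmom (q y)) (bmom dq (q x)).
Proof.
move=> hq; have sc f (r df : R) : is_derive x v f df ->
    is_derive x v (fun y => r * f y) (r * df).
  move=> hf; apply: is_derive_eq (is_derive_scalar_mul
    (is_derive_cst (r : R) x v) hf) _.
  by rewrite mul0r add0r.
have hp b : is_derive x v (fun y => ptr (q y) b) (ptr dq b).
  by apply: is_derive_scalar_sum => a; exact: hq.
apply: is_derive_eq (is_derive_scalar_add (sc _ 2 _ (is_derive_scalar_sum (fun b =>
  is_derive_scalar_sum (fun c => is_derive_scalar_sum (fun d =>
    is_derive_scalar_mul (sc _ (sg4 c) _ (hq d b c)) (hq b c d))))))
  (is_derive_scalar_sum (fun b => sc _ (sg4 b) _
     (is_derive_scalar_mul (hp b) (hp b))))) _.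
rewrite /bmom; congr (_ * _ + _).
  by do 3 (apply: eq_bigr => ? _); ring.
rewrite big_distrr/=; apply: eq_bigr => b _.
by move: (ptr dq) (ptr (q x)) => s t; ring.
Qed.

Section Derivative.
Variables (E : 'M[R]_4) (uE : E \in unitmx) (P : 'I_4 -> 'I_4 -> 'I_4 -> R).
Variables (a mu : 'I_4).
Let F := invmx E.
Let p := fmom E P.
Let V : 'M[R]_4 := delta_mx a mu.
Hypothesis PN : forall d m n, P d m n = - P d n m.

(** The variation hits either index of either factor, which gives four cubic sums; antisymmetry of
    [p] and relabelling identify them in pairs, whence the 2. *)
Lemma bmom_dfmom f : bmom (dfmom E P a f) p = 2 * fqmom p a f.
Proof.
have pN d b c : p d b c = - p d c b by exact: fmomN.
have hptr b : ptr (dfmom E P a f) b = delta4 b a * ptr p f + p a b f.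
  rewrite /ptr /dfmom big_split/= -big_distrr/= -/p; congr (_ + _).
  by rewrite sum_delta4l.
rewrite /bmom /fqmom -addrA mulrDr mulrDr -[in RHS]addrA.
rewrite [in RHS]addrA -[in RHS]mulrDr.
have h1 : \sum_(b < 4) \sum_(c < 4) \sum_(d < 4)
    sg4 c * (dfmom E P a f d b c * p b c d + p d b c * dfmom E P a f b c d) =
    2 * (\sum_(c < 4) \sum_(d < 4) sg4 c * (p a c d * p d f c))
  + 2 * (\sum_(b < 4) \sum_(d < 4) sg4 a * (p b a d * p d b f)).
  transitivity (
     \sum_(b < 4) \sum_(c < 4) \sum_(d < 4) delta4 b a * (sg4 c * (p b c d * p d f c))
   + \sum_(b < 4) \sum_(c < 4) \sum_(d < 4) delta4 c a * (sg4 c * (p b c d * p d b f))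
   + \sum_(b < 4) \sum_(c < 4) \sum_(d < 4) delta4 c a * (sg4 c * (p d b c * p b f d))
   + \sum_(b < 4) \sum_(c < 4) \sum_(d < 4) delta4 d a * (sg4 c * (p d b c * p b c f))).
    rewrite -!big_split/=; apply: eq_bigr => b _; rewrite -!big_split/=.
    apply: eq_bigr => c _; rewrite -!big_split/=; apply: eq_bigr => d _.
    by rewrite /dfmom -/p; ring.
  rewrite sum3_delta1 !sum3_delta2 sum3_delta3.
  have -> : \sum_(b < 4) \sum_(d < 4) sg4 a * (p d b a * p b f d) =
      \sum_(b < 4) \sum_(d < 4) sg4 a * (p b a d * p d b f).
    rewrite exchange_big/=; apply: eq_bigr => b _; apply: eq_bigr => d _.
    by rewrite (pN b d a) (pN d f b); ring.
  have -> : \sum_(b < 4) \sum_(c < 4) sg4 c * (p a b c * p b c f) =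
      \sum_(c < 4) \sum_(d < 4) sg4 c * (p a c d * p d f c).
    rewrite exchange_big/=; apply: eq_bigr => c _; apply: eq_bigr => d _.
    by rewrite (pN a d c) (pN d c f); ring.
  by ring.
have h2 : \sum_(b < 4) sg4 b * (ptr (dfmom E P a f) b * ptr p b) =
    sg4 a * ptr p a * ptr p f + \sum_(b < 4) sg4 b * ptr p b * p a b f.
  rewrite -(sum_delta4l (fun b => sg4 b * ptr p b * ptr p f) a) -big_split/=.
  apply: eq_bigr => b _; rewrite hptr.
  by move: (ptr p) => t; ring.
rewrite h1 h2; move: (ptr p) => t; ring.
Qed.

(** Differentiating [1 / |e|] gives [- e_a^mu / |e|], written with [delta4 a f] so that both
    contributions share the factor [F mu f]. *)
Lemma dhamiltonianE kappa : dhamiltonian_de kappa E P a mu =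
  - (kappa ^+ 2 / (4 * vol E)) *
  \sum_(f < 4) F mu f * (2 * fqmom p a f - delta4 a f * qmom p).
Proof.
have cE i j : {for E, continuous (fun G : 'M[R]_4 => G i j)}.
  exact: coord_continuous.
have v0 : vol E != 0 by rewrite normr_eq0 -unitfE -unitmxE.
have dv := is_derive_vol cE uE (is_derive_coord E V).
have dq := is_derive_qmom (is_derive_fmom uE P a mu).
have dH := is_derive_scalar_mul (is_derive_cst (- (kappa ^+ 2 / 4) : R) E V)
  (is_derive_scalar_mul (is_derive_scalar_inv v0 dv) dq).
have -> : dhamiltonian_de kappa E P a mu =
    (* [hamiltonianE] holds at invertible coframes only, which suffices because these form a
       neighbourhood of [E]. *)
    'D_V (fun G => - (kappa ^+ 2 / 4) * ((vol G)^-1 * qmom (fmom G P))) E.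
  apply: near_eq_derive; near=> G.
  by apply: hamiltonianE; near: G; exact: (unitmx_near cE).
rewrite (@derive_val _ _ _ _ _ _ _ dH) mul0r add0r.
have -> : \tr (invmx E *m V) = F mu a.
  rewrite mxtrace_mulC /mxtrace (bigD1 a)//= big1 ?addr0 => [|i ia].
    rewrite mxE -(sum_delta (fun j => F j a) mu); apply: eq_bigr => j _.
    by rewrite mxE eqxx/= eq_sym.
  by rewrite mxE big1// => j _; rewrite mxE (negPf ia)/= mul0r.
rewrite (bmom_sum (fun f => F mu f) (dfmom E P a)).
under eq_bigr do rewrite bmom_dfmom.
under [in RHS]eq_bigr do rewrite mulrBr.
rewrite sumrB.
have -> : \sum_(i < 4) F mu i * (delta4 a i * qmom p) = F mu a * qmom p.
  rewrite -(sum_delta (fun i => F mu i * qmom p) a).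
  by apply: eq_bigr => i _; rewrite mulrCA.
rewrite -/p; set S := \sum_f _; rewrite -[cst _ _]/(- (kappa ^+ 2 / 4)).
by field.
Unshelve. all: by end_near. Qed.
End Derivative.
End HamiltonianDerivative.

(** * The field equation *)

Lemma local_fields_of_chart (R : realType) (M : topologicalType)
  (A : set (chart R M)) e w (c : chart R M) :
  coframe_field A e -> flat_spin_connection A w -> A c ->
  local_fields (e c) (w c) (chart_im c).
Proof.
move=> [he ue] [hw cw fw] Ac.
have se i j := (he i).1 c Ac j.
have sw nu i j := (hw i j).1 c Ac nu.
split.
- exact: chart_im_open.
- by move=> y Uy; exact: ue.
- by move=> y i j Uy; have [+ _] := se i j 0%N; apply.
- by move=> y mu i j Uy; have [_ h] := se i j 1%N; exact: (h mu).1.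
- by move=> y mu nu i j Uy; have [_ h] := se i j 2%N; have [_ h'] := (h nu).2;
    exact: (h' mu).1.
- by move=> y mu nu i j Uy; have [_ h] := se i j 2%N; have [_ h'] := (h nu).2;
    exact: (h' mu).2.1.
- by move=> y mu nu i j Uy; have [_ h] := sw nu i j 1%N; exact: (h mu).1.
- by move=> y Uy; exact: cw.
- by move=> y mu nu a b Uy; exact: fw.
Qed.

Section FieldEquation.
Context {R : realType}.
Variables (e : 'rV[R]_4 -> 'M[R]_4) (w : 'rV[R]_4 -> 'I_4 -> 'M[R]_4).
Variables (U : set 'rV[R]_4) (H : local_fields e w U).
Variables (x : 'rV[R]_4) (Ux : U x) (kappa : R) (kappa0 : 0 < kappa ^+ 2).
Let E := e x.
Let F := invmx E.
Let uE : E \in unitmx := coframe_unit H Ux.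
Local Notation k := (frame_contortion e w x).
Local Notation frame_dcontortion := (frame_dcontortion e w x).
Local Notation P := (momentum kappa e w x).

Lemma fmom_momentum : fmom E P =
  fun d b c => - (2 * vol E / kappa ^+ 2) * superpot_up k d b c.
Proof.
set r := - _; have -> : P = slot2 F (slot3 F (fun d b c => r * superpot_up k d b c)).
  apply: ext3 => d m n; rewrite (momentumE w uE) /slot2 /slot3 big_distrr/=.
  apply: eq_bigr => b _; rewrite !big_distrr/=; apply: eq_bigr => c _.
  by rewrite -/E -/F -/r; ring.
by rewrite fmom_slot -!slot23C slot2M slot3M EF// slot2_1 slot3_1.
Qed.

Lemma momentumN d m n : P d m n = - P d n m.
Proof.
rewrite !(momentumE w uE) -[RHS]mulrN; congr (_ * _).
rewrite exchange_big/= -sumrN; apply: eq_bigr => c _; rewrite -sumrN.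
apply: eq_bigr => b _; rewrite (superpot_upN (X := k)); first by ring.
exact: frame_contortionN.
Qed.

Lemma ptr_scale (r : R) (S : 'I_4 -> 'I_4 -> 'I_4 -> R) b :
  ptr (fun d b c => r * S d b c) b = r * ptr S b.
Proof. by rewrite /ptr big_distrr. Qed.

Lemma qmom_scale (r : R) (S : 'I_4 -> 'I_4 -> 'I_4 -> R) :
  qmom (fun d b c => r * S d b c) = r ^+ 2 * qmom S.
Proof.
rewrite /qmom [RHS]mulrDr [r ^+ 2 * (2 * _)]mulrCA; congr (2 * _ + _).
  do 3 (rewrite big_distrr/=; apply: eq_bigr => ? _); ring.
rewrite big_distrr/=; apply: eq_bigr => b _; rewrite !ptr_scale.
by move: (ptr S) => t; ring.
Qed.

Lemma fqmom_scale (r : R) (S : 'I_4 -> 'I_4 -> 'I_4 -> R) a f :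
  fqmom (fun d b c => r * S d b c) a f = r ^+ 2 * fqmom S a f.
Proof.
rewrite /fqmom !ptr_scale [RHS]mulrDr 2![r ^+ 2 * (_ + _)]mulrDr.
rewrite 2![r ^+ 2 * (2 * _)]mulrCA; congr (2 * _ + 2 * _ + _ + _).
- do 2 (rewrite big_distrr/=; apply: eq_bigr => ? _); ring.
- do 2 (rewrite big_distrr/=; apply: eq_bigr => ? _); ring.
- by move: (ptr S) => t; ring.
rewrite big_distrr/=; apply: eq_bigr => b _; rewrite !ptr_scale.
by move: (ptr S) => t; ring.
Qed.

Lemma field_equation a mu :
  2 * div_momentum kappa e w x a mu + dhamiltonian_de kappa E P a mu
  = - (4 / kappa ^+ 2) * vol E *
    \sum_(rho < 4) invmx E rho a * einstein_mixed e x rho mu.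
Proof.
rewrite (einsteinE H Ux) (div_momentumE H Ux) (dhamiltonianE uE _ _ momentumN).
rewrite fmom_momentum -/E -/F !mulr_sumr -big_split/=; apply: eq_bigr => f _.
rewrite qmom_scale fqmom_scale.
rewrite -[fqmom _ a f]/(frame_quad_grad k a f) -[qmom _]/(frame_quad k).
have v0 : vol E != 0 by rewrite normr_eq0 -unitfE -unitmxE.
have k0 : kappa != 0 by apply: contraTneq kappa0 => ->; rewrite expr0n/= ltxx.
have Id := frame_identity a f (frame_contortionN e w x) (frame_contortion_diag e w x)
  (frame_dcontortionN H Ux) (frame_dcontortion_diag H Ux).
(* The momentum is [- 2 |e| / kappa^2] times the superpotential and enters the Hamiltonian squared,
   so [kappa^2 / (4 |e|)] becomes [|e| / kappa^2], the factor common to all terms. *)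
transitivity (- (kappa ^+ 2)^-1 * vol E * F mu f *
  (2 * 2 * frame_div k frame_dcontortion a f - 2 * frame_torsion_term k a f - delta4 a
    f * frame_quad k + 2 * frame_quad_grad k a f)).
  by field; rewrite k0 v0.
rewrite Id; field; exact: k0.
Qed.
End FieldEquation.

Theorem mainTheorem5 (R : realType) (M : topologicalType)
  (M_hausdorff : hausdorff_space M) (M_second_countable : @second_countable M)
  (A : set (chart R M)) (A_atlas : smooth_atlas A)
  (kappa : R) (kappa_gt0 : 0 < kappa ^+ 2)
  (e : chart R M -> 'rV[R]_4 -> 'M[R]_4) (e_coframe : coframe_field A e)
  (w : chart R M -> 'rV[R]_4 -> 'I_4 -> 'M[R]_4)
  (w_flat : flat_spin_connection A w)
  (c : chart R M) (Ac : A c) (x : 'rV[R]_4) (cx : chart_im c x)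
  (a mu : 'I_4) :
  2 * div_momentum kappa (e c) (w c) x a mu
  + dhamiltonian_de kappa (e c x) (momentum kappa (e c) (w c) x) a mu
  = - (4 / kappa ^+ 2) * vol (e c x) *
    \sum_(rho < 4) invmx (e c x) rho a * einstein_mixed (e c) x rho mu.
Proof.
exact: (field_equation (local_fields_of_chart e_coframe w_flat Ac) cx).
Qed.
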